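(* Let $X$ be a separable Banach space with property $(M)$ and containing no copy of $\ell_1$. Then $X$ has property $(M^* )$. Furthermore, if $X$ has property $(m_p)$, where $1<p\le\infty$, then $X$ has property $(m_q^* )$, where $1/p+1/q=1$.
   Context: Let $X$ be a separable Banach space. Property $(M)$: $\limsup_n\|u+x_n\|=\limsup_n\|v+x_n\|$ whenever $u,v\in X$, $\|u\|=\|v\|$, and $x_n\to0$ weakly in $X$. Property $(M^* )$: $\limsup_n\|u^*+x_n^*\|=\limsup_n\|v^*+x_n^*\|$ whenever $u^*,v^*\in X^*$, $\|u^*\|=\|v^*\|$, and $x_n^*\to0$ weak$^*$ in $X^*$. For $1\le p\le\infty$, property $(m_p)$: $\limsup_n\|x+x_n\|=\|(\|x\|,\limsup_n\|x_n\|)\|_p$ whenever $x\in X$ and $x_n\to0$ weakly in $X$, where $\|\cdot\|_p$ is the $\ell_p$-norm on $\mathbb{R}^2$. Property $(m_p^* )$: $\limsup_n\|x^*+x_n^*\|=\|(\|x^*\|,\limsup_n\|x_n^*\|)\|_p$ whenever $x^*\in X^*$ and $x_n^*\to0$ weak$^*$ in $X^*$. ''Containing no copy of $\ell_1$'' means having no closed subspace isomorphic to $\ell_1$. *)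

(* Defs.v *)
From HB Require Import structures.
From mathcomp Require Import all_boot all_order all_algebra.
From mathcomp Require Import all_classical all_reals all_analysis.
Set Implicit Arguments.
Unset Strict Implicit.
Unset Printing Implicit Defensive.
Import Order.TTheory GRing.Theory Num.Theory.
Import numFieldNormedType.Exports.
Local Open Scope classical_set_scope.
Local Open Scope ring_scope.

Definition separable (T : topologicalType) : Prop :=
  exists2 D : set T, countable D & dense D.

Section dual.
Context {R : realType} (X : normedModType R).

(* The topological dual, as a subset of the space of all functions, so that
   the sum of two functionals is the pointwise sum. *)
Definition dual : set (X -> R) := [set f : X -> R | scalar f /\ continuous f].

(* Intended for elements of [dual], on which the supremum is finite. *)
Definition dual_norm (f : X -> R) : R :=
  sup [set `|f x| | x in [set x : X | `|x| <= 1]].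

Definition weakly_null (x_ : nat -> X) : Prop :=
  forall f, dual f -> f (x_ n) @[n --> \oo] --> (0 : R).

Definition weakstar_null (f_ : nat -> X -> R) : Prop :=
  (forall n, dual (f_ n)) /\ forall x, f_ n x @[n --> \oo] --> (0 : R).

End dual.
Arguments dual {R} X _.

(* Upper limit in the extended reals, which avoids a boundedness side
   condition. *)
Definition limsup {R : realType} (u : nat -> R) : \bar R :=
  limn_esup (fun n => (u n)%:E).

(* The l_p-norm of (a, b) for nonnegative a, b and 1 <= p <= +oo; the value at
   p = -oo is irrelevant. *)
Definition lp_norm2 {R : realType} (p a b : \bar R) : \bar R :=
  match p with
  | r%:E => ((a `^ r + b `^ r) `^ r^-1)%E
  | +oo%E => maxe a b
  | -oo%E => 0%E
  end.

Section properties.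
Context {R : realType} (X : normedModType R).

Definition property_M : Prop :=
  forall (u v : X) (x_ : nat -> X), `|u| = `|v| -> weakly_null x_ ->
    limsup (fun n => `|u + x_ n|) = limsup (fun n => `|v + x_ n|).

Definition property_Mstar : Prop :=
  forall (u v : X -> R) (f_ : nat -> X -> R), dual X u -> dual X v ->
    dual_norm u = dual_norm v -> weakstar_null f_ ->
    limsup (fun n => dual_norm (u + f_ n)) =
    limsup (fun n => dual_norm (v + f_ n)).

Definition property_m (p : \bar R) : Prop :=
  forall (x : X) (x_ : nat -> X), weakly_null x_ ->
    limsup (fun n => `|x + x_ n|) =
    lp_norm2 p `|x|%:E (limsup (fun n => `|x_ n|)).

Definition property_mstar (p : \bar R) : Prop :=
  forall (f : X -> R) (f_ : nat -> X -> R), dual X f -> weakstar_null f_ ->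
    limsup (fun n => dual_norm (f + f_ n)) =
    lp_norm2 p (dual_norm f)%:E (limsup (fun n => dual_norm (f_ n))).

End properties.

Section ell1.
Context {R : realType}.

Definition ell1 : set (nat -> R) := [set a : nat -> R | cvgn (series (fun n => `|a n|))].

Definition ell1_norm (a : nat -> R) : R := limn (series (fun n => `|a n|)).

Context (X : normedModType R).

Definition closed_subspace (Y : set X) : Prop :=
  [/\ closed Y, Y 0 & forall (r : R) x y, Y x -> Y y -> Y (r *: x + y)].

(* [T] matters only on [ell1], where it is a linear bijection onto [Y] that is
   bounded and has bounded inverse. *)
Definition isomorphic_to_ell1 (Y : set X) : Prop :=
  exists T : (nat -> R) -> X,
    [/\ set_bij ell1 Y T,
        forall (r : R) a b, ell1 a -> ell1 b ->
          T (fun n => r * a n + b n) = r *: T a + T b,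
        exists C : R, forall a, ell1 a -> `|T a| <= C * ell1_norm a &
        exists C : R, forall a, ell1 a -> ell1_norm a <= C * `|T a| ].

Definition contains_copy_of_ell1 : Prop :=
  exists2 Y : set X, closed_subspace Y & isomorphic_to_ell1 Y.

End ell1.

(* Main.v *)
From HB Require Import structures.
Require Import Defs.
From mathcomp Require Import all_boot all_order all_algebra.
From mathcomp Require Import all_classical all_reals all_analysis.
From mathcomp Require Import ring lra.
Set Implicit Arguments.
Unset Strict Implicit.
Unset Printing Implicit Defensive.
Import Order.TTheory GRing.Theory Num.Theory.
Import numFieldNormedType.Exports.
Local Open Scope classical_set_scope.
Local Open Scope ring_scope.

(* Let (f_n) be weak* null and let unit vectors x_n nearly norm u* + f_n; by
   Rosenthal's l1 theorem (x_n) may be taken weakly Cauchy. Write K_m for the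
   convex hull of {x_j : j >= m} and d for the limit of the distances from 0 to
   K_m; then lim u*(x_n) <= |u*| d. The key point (hull_translate) is that if
   |v| <= d then, for suitable D in K_m with m large, v + (x_n - D) still has
   norm at most 1 + e for all large n. So the weak limit of (x_n) in the bidual
   can be traded for any v in X with v*(v) close to |v*| d, and testing v* + f_n
   on v + (x_n - D) gives (M^* ). Under (m_p) the sequence x_n - D_n is weakly
   null and the same test vectors reduce (m_q^* ) to Hoelder's inequality and its
   equality case.

   For the key point let t be the asymptotic infimum over D of
   limsup |u + x_n - D|, where |u| = d; by (M) it only depends on |u|. If t > 1,
   take C, C', D', D in K, each much further out than the previous one, put
   C2 = (C + r C')/(1 + r) and D2 = (D + r D')/(1 + r), and use convexity along
   x_n, C2 - D2 + x_n and (1 + r)(C2 - D2) + x_n = C + r(C' - D') - D + x_n. The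
   middle norm is at least t, so the last one is at least t + r(t - 1), whereas
   by (M) it is at most t + (|C + r(C' - D')| - d). Hence the norm has slope at
   least t - 1 at C in far directions C' - D', which by (M) holds at every
   vector. But directions that eventually are weakly null cannot have this
   property in a complete space (weakly_null_sets_flat). *)

(** * Hahn-Banach theorem through minimal sublinear functionals *)

Section sublinear.
Context {R : realType} (X : lmodType R).
Implicit Types (p q : X -> R) (x y u : X).

Definition sublinear p : Prop :=
  (forall x y, p (x + y) <= p x + p y) /\
  (forall (r : R) x, 0 <= r -> p (r *: x) = r * p x).

Lemma sublinear0 p : sublinear p -> p 0 = 0.
Proof. by case=> _ pZ; rewrite -(scale0r 0) pZ// mul0r. Qed.

Lemma sublinear_geN p x : sublinear p -> - p (- x) <= p x.
Proof.
move=> sp; have [pD _] := sp; have := pD x (- x).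
by rewrite subrr sublinear0//; lra.
Qed.

(** For sublinear [p], the largest sublinear functional below [p] whose value at [- y] is at most
    [- p y]. *)
Definition shave p y x : R := inf [set p (x + t *: y) - t * p y | t in [set t | 0 <= t]].

Lemma shave_lbound p y x : sublinear p ->
  lbound [set p (x + t *: y) - t * p y | t in [set t | 0 <= t]] (- p (- x)).
Proof.
move=> [pD pZ] _ [t /= t0 <-]; rewrite -pZ//.
have := pD (x + t *: y) (- x).
by rewrite (addrC x) addrK; lra.
Qed.

Lemma shave_le p y x t : sublinear p -> 0 <= t ->
  shave p y x <= p (x + t *: y) - t * p y.
Proof.
move=> sp t0; apply: ge_inf; last by exists t.
by exists (- p (- x)); exact: shave_lbound.
Qed.

Lemma shave_adherent p y x e : sublinear p -> 0 < e ->
  exists2 t, 0 <= t & p (x + t *: y) - t * p y < shave p y x + e.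
Proof.
move=> sp e0; have [|_ [t t0 <-] ?] := inf_adherent e0
  (E := [set p (x + t *: y) - t * p y | t in [set t | 0 <= t]]).
  split; first by exists (p (x + 0 *: y) - 0 * p y), 0 => /=.
  by exists (- p (- x)); exact: shave_lbound.
by exists t.
Qed.

(** Near-optimal parameters for [x] and [z] add up to an admissible one for [x + z]; scaling by
    [r > 0] rescales the parameter. *)
Lemma shave_sublinear p y : sublinear p -> sublinear (shave p y).
Proof.
move=> sp; have [pD pZ] := sp; split => [x z|r x].
  apply/ler_addgt0Pr => e e0; have e2 : 0 < e / 2 by lra.
  have [t t0 xt] := shave_adherent y x sp e2.
  have [s s0 zs] := shave_adherent y z sp e2.
  have := shave_le y (x + z) sp (addr_ge0 t0 s0).
  have -> : x + z + (t + s) *: y = (x + t *: y) + (z + s *: y).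
    by rewrite scalerDl addrACA.
  have := pD (x + t *: y) (z + s *: y).
  by lra.
rewrite le_eqVlt => /predU1P[<-|r0].
  rewrite scale0r mul0r; apply/eqP; rewrite eq_le; apply/andP; split.
    have := shave_le y 0 sp (lexx 0).
    by rewrite scale0r addr0 (sublinear0 sp) mul0r subr0.
  apply: lb_le_inf; first by exists (p (0 + 0 *: y) - 0 * p y), 0 => /=.
  by move=> z /(shave_lbound sp); rewrite oppr0 (sublinear0 sp) oppr0.
apply/eqP; rewrite eq_le; apply/andP; split; apply/ler_addgt0Pr => e e0.
  have er : 0 < e / r by rewrite divr_gt0.
  have [t t0 xt] := shave_adherent y x sp er.
  have := shave_le y (r *: x) sp (mulr_ge0 (ltW r0) t0).
  rewrite -scalerA -scalerDr (pZ _ _ (ltW r0)) => /le_trans; apply.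
  have -> : e = r * (e / r) by field; rewrite gt_eqF.
  by rewrite -mulrA -mulrBr -mulrDr ler_pM2l// ltW.
have [t t0 xt] := shave_adherent y (r *: x) sp e0.
have tr : 0 <= t / r by rewrite divr_ge0// ltW.
have := shave_le y x sp tr.
rewrite -(ler_pM2l r0) => /le_trans; apply.
rewrite mulrBr -(pZ _ _ (ltW r0)) scalerDr scalerA.
have -> : r * (t / r) = t by field; rewrite gt_eqF.
rewrite mulrA.
have -> : r * (t / r) = t by field; rewrite gt_eqF.
exact: ltW.
Qed.

Lemma shave_le_id p y x : sublinear p -> shave p y x <= p x.
Proof.
by move=> sp; have := shave_le y x sp (lexx 0); rewrite scale0r addr0 mul0r subr0.
Qed.

(* A minimal sublinear functional is linear, because it coincides with all its
   shavings. *)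
Lemma sublinear_minorant p : sublinear p ->
  exists2 f : X -> R, scalar f & forall x, f x <= p x.
Proof.
move=> sp; pose T := {q : X -> R | sublinear q /\ forall x, q x <= p x}.
(* The order is reversed, so that a maximal element for Zorn is a minimal functional. *)
pose leT (q1 q2 : T) := `[< forall x, sval q2 x <= sval q1 x >].
have [||||q qmin] := @Zorn T leT.
- by move=> q; apply/asboolP => x.
- move=> q1 q2 q3 /asboolP h12 /asboolP h23; apply/asboolP => x.
  exact: le_trans (h23 x) (h12 x).
- move=> q1 q2 /asboolP h12 /asboolP h21.
  case: q1 q2 h12 h21 => [q1 P1] [q2 P2] /= h12 h21.
  have q12 : q1 = q2 by apply/funext => x; apply/eqP; rewrite eq_le h12 h21.
  by subst q2; rewrite (Prop_irrelevance P1 P2).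
- move=> A Atot; have [[q0 Aq0]|A0] := pselect (exists q : T, A q); last first.
    exists (exist _ p (conj sp (fun=> lexx _))) => s As.
    by exfalso; apply: A0; exists s.
  (* A nonempty chain is bounded by its pointwise infimum [m]; by totality, the smaller of two
     members serves at both points in the proof of subadditivity. *)
  pose E x := [set r | exists2 q : T, A q & sval q x = r].
  pose m x := inf (E x).
  have E0 x : E x !=set0 by exists (sval q0 x), q0.
  have Elb x : lbound (E x) (- p (- x)).
    move=> _ [q Aq <-]; have [sq qp] := svalP q.
    by apply: le_trans (sublinear_geN x sq); rewrite lerN2.
  have mle x (q : T) : A q -> m x <= sval q x.
    by move=> Aq; apply: ge_inf; [exists (- p (- x))|exists q].
  have madh x e : 0 < e -> exists2 q : T, A q & sval q x < m x + e.
    move=> e0; have [|_ [q Aq <-] ?] := inf_adherent e0 (E := E x).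
      by split => //; exists (- p (- x)).
    by exists q.
  have sm : sublinear m.
    split => [x y|r x r0].
      apply/ler_addgt0Pr => e e0; have e2 : 0 < e / 2 by lra.
      have [q1 A1 h1] := madh x _ e2; have [q2 A2 h2] := madh y _ e2.
      have [q [Aq]] : exists q : T, [/\ A q, sval q x <= sval q1 x &
          sval q y <= sval q2 y].
        have [/asboolP h|/asboolP h] := Atot _ _ A1 A2.
          by exists q2; split.
        by exists q1; split.
      have [[qD _] _] := svalP q; have := qD x y; have := mle (x + y) _ Aq.
      by lra.
    move: r0; rewrite le_eqVlt => /predU1P[<-|r0].
      rewrite scale0r mul0r; apply/eqP; rewrite eq_le; apply/andP; split.
        by rewrite (le_trans (mle _ _ Aq0))// sublinear0//; case: (svalP q0).
      apply: lb_le_inf => // _ [q Aq <-].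
      by rewrite sublinear0//; case: (svalP q).
    apply/eqP; rewrite eq_le; apply/andP; split; apply/ler_addgt0Pr => e e0.
      have er : 0 < e / r by rewrite divr_gt0.
      have [q Aq h] := madh x _ er; have [[_ qZ] _] := svalP q.
      apply: le_trans (mle _ _ Aq) _; rewrite (qZ _ _ (ltW r0)).
      have -> : e = r * (e / r) by field; rewrite gt_eqF.
      by rewrite -mulrDr ler_pM2l// ltW.
    have [q Aq h] := madh (r *: x) _ e0; have [[_ qZ] _] := svalP q.
    apply: le_trans (ltW h); rewrite (qZ _ _ (ltW r0)) ler_pM2l//.
    exact: mle.
  have mp x : m x <= p x.
    by apply: le_trans (mle x _ Aq0) _; case: (svalP q0).
  exists (exist _ m (conj sm mp)) => s As; apply/asboolP => x /=.
  exact: mle.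
have [sq qp] := svalP q; exists (sval q) => //.
have shq y : shave (sval q) y = sval q.
  have sp' : forall x, shave (sval q) y x <= p x.
    by move=> x; apply: le_trans (qp x); exact: shave_le_id.
  have le_q : leT q (exist _ _ (conj (shave_sublinear y sq) sp')).
    by apply/asboolP => x /=; exact: shave_le_id.
  by have /(congr1 sval) := qmin _ le_q.
have [qD qZ] := sq.
have {}qD x y : sval q (x + y) = sval q x + sval q y.
  apply/eqP; rewrite eq_le qD/=.
  have := shave_le y x sq ler01; rewrite shq scale1r mul1r; lra.
have qN x : sval q (- x) = - sval q x.
  by have := qD x (- x); rewrite subrr sublinear0//; lra.
move=> a x y; rewrite qD; congr (_ + _).
have [a0|a0] := leP 0 a; first exact: qZ.
rewrite -[a *: x]opprK -scaleNr qN qZ ?oppr_ge0 ?ltW// mulNr opprK.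
by [].
Qed.

(** A linear minorant of [shave p u] is at most [- p u] at [- u], hence attains [p u] at [u]. *)
Lemma Hahn_Banach_support p u : sublinear p ->
  exists f : X -> R, [/\ scalar f, f u = p u & forall x, f x <= p x].
Proof.
move=> sp; have [f lf fp] := sublinear_minorant (shave_sublinear u sp).
exists f; split => // [|x]; last exact: le_trans (fp x) (shave_le_id _ _ sp).
apply/eqP; rewrite eq_le (le_trans (fp u) (shave_le_id _ _ sp))/=.
have := fp (- u); have := shave_le u (- u) sp ler01.
rewrite scale1r addNr (sublinear0 sp) mul1r sub0r => h /le_trans/(_ h).
have -> : - u = (-1) *: u + 0 by rewrite scaleN1r addr0.
rewrite lf.
have -> : f 0 = 0.
  by have := lf (-1) 0 0; rewrite scaler0 addr0; lra.
by rewrite addr0 mulN1r lerN2.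
Qed.

End sublinear.

(** * Bounded functionals and the dual norm *)

Section dual_theory.
Context {R : realType} {X : normedModType R}.
Implicit Types (f : X -> R) (x y : X).

Lemma functionalD f x y : scalar f -> f (x + y) = f x + f y.
Proof. by move=> lf; rewrite -[x in LHS]scale1r lf mul1r. Qed.

Lemma functional0 f : scalar f -> f 0 = 0.
Proof. by move=> /(@functionalD _ 0 0); rewrite addr0; lra. Qed.

Lemma functionalZ f a x : scalar f -> f (a *: x) = a * f x.
Proof. by move=> lf; rewrite -[_ *: _]addr0 lf functional0// addr0. Qed.

Lemma functionalB f x y : scalar f -> f (x - y) = f x - f y.
Proof. by move=> lf; rewrite -scaleN1r functionalD// functionalZ// mulN1r. Qed.

Lemma functionalN f x : scalar f -> f (- x) = - f x.
Proof. by move=> lf; rewrite -scaleN1r functionalZ// mulN1r. Qed.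

Lemma dual_of_bound f C : scalar f -> (forall x, `|f x| <= C * `|x|) -> dual X f.
Proof.
move=> lf fC; split => //.
pose F : {linear X -> R^o} := HB.pack (f : X -> R^o)
  (GRing.isLinear.Build R X R^o *:%R (f : X -> R^o) lf).
apply/(@linear_bounded_continuous _ _ _ F)/linear_boundedP.
near=> r => x; apply: le_trans (fC x) _.
by apply: ler_wpM2r => //; near: r; apply: nbhs_pinfty_ge; rewrite num_real.
Unshelve. all: by end_near. Qed.

Lemma dual_bound f : dual X f -> exists2 C, 0 < C & forall x, `|f x| <= C * `|x|.
Proof.
move=> [lf cf].
pose F : {linear X -> R^o} := HB.pack (f : X -> R^o)
  (GRing.isLinear.Build R X R^o *:%R (f : X -> R^o) lf).
have /linear_boundedP [C0 [_ CP]] : bounded_near F (nbhs 0).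
  by apply/linear_bounded_continuous.
exists (`|C0| + 1); first by rewrite ltr_wpDl.
by apply: CP; have := ler_norm C0; lra.
Qed.

Lemma dual_norm_has_sup f : dual X f ->
  has_sup [set `|f x| | x in [set x : X | `|x| <= 1]].
Proof.
move=> /dual_bound[C C0 fC]; split; first by exists `|f 0|, 0 => //=; rewrite normr0.
exists C => _ [x /= x1 <-]; apply: le_trans (fC x) _.
by rewrite -[leRHS]mulr1 ler_pM2l.
Qed.

Lemma dual_norm_ge0 f : dual X f -> 0 <= dual_norm f.
Proof.
move=> df; have [lf _] := df; apply: le_trans (normr_ge0 (f 0)) _.
by apply: (sup_upper_bound (dual_norm_has_sup df)); exists 0 => //=; rewrite normr0.
Qed.

Lemma dual_norm_bound f x : dual X f -> `|f x| <= dual_norm f * `|x|.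
Proof.
move=> df; have [lf _] := df; have [->|x0] := eqVneq x 0.
  by rewrite functional0// !normr0 mulr0.
have nx : 0 < `|x| by rewrite normr_gt0.
have : `|f (`|x|^-1 *: x)| <= dual_norm f.
  apply: (sup_upper_bound (dual_norm_has_sup df)); exists (`|x|^-1 *: x) => //=.
  by rewrite normrZ normfV normr_id mulVf// gt_eqF.
by rewrite functionalZ// normrM normfV normr_id mulrC ler_pdivrMr.
Qed.

Lemma dual_norm_le f C : dual X f -> 0 <= C ->
  (forall x, `|x| <= 1 -> f x <= C) -> dual_norm f <= C.
Proof.
move=> df C0 fC; have [lf _] := df; apply: ge_sup.
  by case: (dual_norm_has_sup df).
move=> _ [x /= x1 <-]; rewrite ler_norml fC// andbT lerNl -functionalN//.
by apply: fC; rewrite normrN.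
Qed.

Lemma dual_norm_attain f e : dual X f -> 0 < e ->
  exists2 x, `|x| <= 1 & dual_norm f - e < f x.
Proof.
move=> df e0; have [lf _] := df.
have [_ [x /= x1 <-]] := sup_adherent e0 (dual_norm_has_sup df).
rewrite -/(dual_norm f); case: (ger0P (f x)) => _ h; first by exists x.
by exists (- x); rewrite ?normrN// functionalN.
Qed.

Lemma dualD f g : dual X f -> dual X g -> dual X (f + g).
Proof.
move=> df dg; have [lf _] := df; have [lg _] := dg.
apply: (@dual_of_bound _ (dual_norm f + dual_norm g)).
  by move=> a x y; rewrite !fctE lf lg mulrDr addrACA.
move=> x; rewrite mulrDl; apply: le_trans (ler_normD _ _) _.
by apply: lerD; exact: dual_norm_bound.
Qed.

Lemma norming_functional x : exists f, [/\ dual X f, f x = `|x| & forall y, `|f y| <= `|y|].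
Proof.
have [|f [lf fx fle]] := @Hahn_Banach_support R X (fun y => `|y|) x.
  by split => [y z|r y r0]; [exact: ler_normD|rewrite normrZ ger0_norm].
have fn y : `|f y| <= `|y|.
  by rewrite ler_norml fle andbT lerNl -functionalN// -[leRHS]normrN.
exists f; split => //; apply: (@dual_of_bound _ 1) => // y.
by rewrite mul1r.
Qed.

End dual_theory.

(** Merges finitely many thresholds of eventual statements into one index. *)
Lemma exists_ub_seq (s : seq nat) : exists k, all (fun n => (n <= k)%N) s.
Proof.
exists (\max_(i <- s) i); apply/allP => n ns.
by rewrite (big_rem n ns) leq_maxl.
Qed.

(** * Limits and upper limits in terms of epsilon *)

Section cvg_limsup.
Context {R : realType}.
Implicit Types (u v : nat -> R).

Lemma cvgn_eventually u (l : R) : u @ \oo --> l <->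
  forall e : R, 0 < e -> exists N, forall n, (N <= n)%N -> `|u n - l| <= e.
Proof.
split => [/cvgrPdist_le ul e /ul [N _ h]|h].
  by exists N => n Nn; rewrite distrC; exact: h.
apply/cvgrPdist_le => e /h[N hN]; exists N => // n /= Nn.
by rewrite distrC; exact: hN.
Qed.

Lemma cvgn_le u (l c : R) N : u @ \oo --> l -> (forall n, (N <= n)%N -> u n <= c) -> l <= c.
Proof.
move=> /cvgn_eventually ul uc; apply/ler_addgt0Pr => e /ul[N' hN'].
have := uc (maxn N N') (leq_maxl _ _).
by have := hN' (maxn N N') (leq_maxr _ _); rewrite distrC => /(le_trans (ler_norm _)); lra.
Qed.

Lemma cvgn_ge u (l c : R) N : u @ \oo --> l -> (forall n, (N <= n)%N -> c <= u n) -> c <= l.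
Proof.
move=> /cvgn_eventually ul uc; apply/ler_addgt0Pr => e /ul[N' hN'].
have := uc (maxn N N') (leq_maxl _ _).
by have := hN' (maxn N N') (leq_maxr _ _) => /(le_trans (ler_norm _)); lra.
Qed.

Lemma limsup_le u (a : R) : (limsup u <= a%:E)%E <->
  forall e, 0 < e -> exists N, forall n, (N <= n)%N -> u n <= a + e.
Proof.
split => [ua e e0|h].
  have : (limsup u < (a + e)%:E)%E by apply: le_lt_trans ua _; rewrite lte_fin; lra.
  move=> /ereal_inf_lt[_ [A [N _ NA] <-] Ae]; exists N => n Nn.
  rewrite -lee_fin; apply: le_trans (ltW Ae); apply: ereal_sup_ubound.
  by exists n => //; exact: NA.
apply/lee_addgt0Pr => e e0; have [N hN] := h _ e0.
apply: le_trans (_ : ereal_sup [set (u n)%:E | n in [set n | (N <= n)%N]] <= _)%E.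
  by apply: ereal_inf_lbound; exists [set n | (N <= n)%N] => //; exists N.
by apply: ge_ereal_sup => _ [n /= Nn <-]; rewrite lee_fin hN.
Qed.

Lemma limsup_ge u (a : R) : (a%:E <= limsup u)%E <->
  forall e, 0 < e -> forall N, exists2 n, (N <= n)%N & a - e <= u n.
Proof.
split => [ua e e0 N|h].
  apply/not_exists2P => h.
  have : (limsup u <= (a - e)%:E)%E.
    apply/limsup_le => e' e'0; exists N => n Nn.
    by have [//|/negP] := h n; rewrite -ltNge => /ltW; lra.
  by move=> /(le_trans ua); rewrite lee_fin; lra.
apply/lee_subgt0Pr => e e0; apply: le_ereal_inf_tmp => _ [A [N _ NA] <-].
have [n Nn hn] := h _ e0 N.
apply: le_trans (_ : (u n)%:E <= _)%E; first by rewrite lee_fin.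
by apply: ereal_sup_ubound; exists n => //; exact: NA.
Qed.

Lemma limsup_ge0 u : (forall n, 0 <= u n) -> (0 <= limsup u)%E.
Proof.
move=> u0; apply/limsup_ge => e e0 N; exists N => //.
by have := u0 N; lra.
Qed.

(** Made for test vectors of norm at most [1 + e] on which a functional loses a multiple of [e]:
    both defects vanish in the limit. *)
Lemma limsup_ge_scaled u (l C : R) : (forall n, 0 <= u n) -> 0 <= C ->
  (forall e, 0 < e -> forall N, exists2 n, (N <= n)%N & l - C * e <= u n * (1 + e)) ->
  (l%:E <= limsup u)%E.
Proof.
move=> u0 C0 h; have [l0|l0] := leP l 0.
  by apply: le_trans (limsup_ge0 u0); rewrite lee_fin.
apply/limsup_ge => e e0 N.
(* The parameter e' = e / (C + l) gives (l - e)(1 + e') <= l - C e'. *)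
have e'0 : 0 < e / (C + l) by rewrite divr_gt0//; lra.
have [n Nn hn] := h _ e'0 N; exists n => //.
have e'E : (C + l) * (e / (C + l)) = e by field; lra.
have p1 : 0 < 1 + e / (C + l) by lra.
rewrite -(ler_pM2r p1); apply: le_trans hn.
by have := mulr_gt0 e0 e'0; lra.
Qed.

(** Reduces a comparison of possibly infinite upper limits to real lower bounds. *)
Lemma ereal_le_fin (a b : \bar R) : (forall l : R, (l%:E <= a)%E -> (l%:E <= b)%E) -> (a <= b)%E.
Proof.
case: a => [a|h|_]; [by apply|rewrite leye_eq; apply/eqP/eqyP => l _; exact: h (leey _)|].
exact: leNye.
Qed.

End cvg_limsup.

(** * Property (M) uniformly on weakly null sequences of sets *)

Section weakly_null_sets.
Context {R : realType} {X : normedModType R}.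
Implicit Types (B : nat -> set X) (u v w y z : X).

Definition weakly_null_sets B : Prop :=
  forall y_ : nat -> X, (forall n, B n (y_ n)) -> weakly_null y_.

Definition scale_sets (r : R) B n : set X := [set r *: y | y in B n].

Lemma weakly_null_scale r B : weakly_null_sets B -> weakly_null_sets (scale_sets r B).
Proof.
move=> wB y_ By; have /choice[z_ zP] : forall n, exists z, B n z /\ r *: z = y_ n.
  by move=> n; have [z] := By n; exists z.
move=> f df; have [lf _] := df.
have -> : (fun n => f (y_ n)) = (fun n => r * f (z_ n)).
  by apply/funext => n; have [_ <-] := zP n; rewrite functionalZ.
rewrite -(mulr0 r); apply: cvgM; first exact: cvg_cst.
by apply: wB => // n; case: (zP n).
Qed.

Section property_M.
Variable (C : R) (B : nat -> set X).
Hypothesis (MX : property_M X) (wB : weakly_null_sets B).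
Hypothesis (dB : forall m n, (m <= n)%N -> B n `<=` B m).
Hypothesis (bB : forall n y, B n y -> `|y| <= C).

(** If the inequality failed somewhere in every [B m], one failing vector from each would form a
    weakly null sequence contradicting (M). *)
Lemma property_M_eq u v e : `|u| = `|v| -> 0 < e ->
  exists m, forall y, B m y -> `|u + y| <= `|v + y| + e.
Proof.
move=> uv e0; apply: contrapT => h.
have /choice[y_ yP] : forall m, exists y, B m y /\ `|v + y| + e < `|u + y|.
  move=> m; apply: contrapT => hm; apply: h; exists m => y Bmy.
  by rewrite leNgt; apply/negP => uvy; apply: hm; exists y.
have := MX uv (wB (fun n => (yP n).1)).
set U := limsup _; set V := limsup _ => UV.
have V0 : (0 <= V)%E by apply: limsup_ge0 => n.
have VC : (V <= (`|v| + C)%:E)%E.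
  apply/limsup_le => e' e'0; exists 0%N => n _.
  by have := ler_normD v (y_ n); have := bB (yP n).1; lra.
have [b Vb] : exists b : R, V = b%:E.
  by case: (V) V0 VC => // b _ _; exists b.
have /limsup_ge h1 : (b%:E <= V)%E by rewrite Vb.
have /limsup_le h2 : (U <= b%:E)%E by rewrite UV Vb.
have e4 : 0 < e / 4 by lra.
have [N hN] := h2 _ e4; have [n /hN un vn] := h1 _ e4 N.
by have [_ yn] := yP n; lra.
Qed.

(* Convexity of the norm promotes (M) from equal norms to a comparison of
   arbitrary norms. *)
Lemma property_M_le u v e : 0 < e -> exists m, forall y, B m y ->
  `|u + y| <= `|v + y| + Num.max 0 (`|u| - `|v|) + e.
Proof.
move=> e0.
have [uv|vu] := leP `|u| `|v|; last first.
  have u0 : 0 < `|u| by apply: le_lt_trans vu.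
  (* Here [u] is shrunk to the norm of [v]; the removed part costs |u| - |v|. *)
  pose s := `|v| / `|u|.
  have [|m hm] := @property_M_eq (s *: u) v _ _ e0.
    by rewrite normrZ ger0_norm ?divr_ge0 ?normr_ge0// /s mulfVK// gt_eqF.
  exists m => y /hm h.
  have -> : u + y = (s *: u + y) + (1 - s) *: u.
    by rewrite addrAC -scalerDl (addrC s) subrK scale1r.
  apply: le_trans (ler_normD _ _) _.
  rewrite normrZ ger0_norm; last by rewrite subr_ge0 ler_pdivrMr// mul1r ltW.
  have -> : (1 - s) * `|u| = `|u| - `|v| by rewrite /s mulrBl mul1r mulfVK// gt_eqF.
  by rewrite max_r; lra.
(* A shorter [u] lies on the segment between antipodal vectors of norm |v|, to both of which
   [property_M_eq] applies. *)
have [u' [s [u'v s0 s1 us]]] : exists u' s, [/\ `|u'| = `|v|, 0 <= s, s <= 1 &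
    u = s *: u' + (1 - s) *: (- u')].
  have [->|u0] := eqVneq u 0.
    exists v, (1 / 2); split => //; rewrite ?divr_ge0 ?ler_pdivrMr//; first lra.
    by rewrite scalerN -scalerBl (_ : _ - _ = 0) ?scale0r//; lra.
  have nu : 0 < `|u| by rewrite normr_gt0.
  have nv : 0 < `|v| by apply: lt_le_trans uv.
  exists ((`|v| / `|u|) *: u), ((1 + `|u| / `|v|) / 2).
  have le1 : `|u| / `|v| <= 1 by rewrite ler_pdivrMr// mul1r.
  have ge0 : 0 <= `|u| / `|v| by rewrite divr_ge0.
  split; [|lra|lra|].
    by rewrite normrZ ger0_norm ?divr_ge0// mulfVK// gt_eqF.
  rewrite scalerN -scalerBl scalerA -[LHS]scale1r; congr (_ *: _).
  by field; rewrite !gt_eqF.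
have [m1 h1] := property_M_eq u'v e0.
have [|m2 h2] := @property_M_eq (- u') v _ _ e0; first by rewrite normrN.
exists (maxn m1 m2) => y Bmy; rewrite us.
have -> : s *: u' + (1 - s) *: - u' + y = s *: (u' + y) + (1 - s) *: (- u' + y).
  by rewrite !scalerDr addrACA -scalerDl (addrC s) subrK scale1r.
have {h1} := h1 _ (dB (leq_maxl _ _) Bmy).
have {h2} := h2 _ (dB (leq_maxr _ _) Bmy).
set N1 := `| _ + y|; set N2 := `|v + y|; set N3 := `|u' + y| => h1 h2.
apply: le_trans (ler_normD _ _) _.
rewrite !normrZ !ger0_norm// ?subr_ge0// -/N1 -/N3.
have m0 : 0 <= Num.max 0 (`|s *: u' + (1 - s) *: - u'| - `|v|) by rewrite le_max lexx.
apply: le_trans (_ : N2 + e <= _); last by lra.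
have := ler_wpM2l s0 h2; have s0' : 0 <= 1 - s by lra.
by have := ler_wpM2l s0' h1; lra.
Qed.

End property_M.
End weakly_null_sets.

(** * Flatness of the norm in weakly null directions *)

Section roughness.
Context {R : realType} (X : completeNormedModType R).

(* If the norm had slope at least [eta] at every nonzero [w] in arbitrarily far
   directions of [B], then [u_oo = u_0 + sum_j 2^-j z_j] with suitable [z_j] in
   [B j] would satisfy [|u_oo| >= |u_k| + eta sum_(j > k) 2^-j] for all [k]; a
   functional norming [u_oo] then exceeds [eta] at infinitely many [z_j]. *)
Lemma weakly_null_sets_flat (C : R) (B : nat -> set X) (u0 : X) (eta : R) :
  weakly_null_sets B -> (forall n, B n !=set0) ->
  (forall n y, B n y -> `|y| <= C) -> u0 != 0 -> 0 < eta ->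
  exists w r m, [/\ w != 0, 0 < r & forall z, B m z -> `|w + r *: z| <= `|w| + eta * r].
Proof.
move=> wB B0 bB u00 eta0; apply: contrapT => h.
pose rho n : R := 2^-1 ^+ n.
have rho0 n : 0 < rho n by rewrite exprn_gt0// invr_gt0.
have rhoS n : rho n = rho n.+1 + rho n.+1 by rewrite /rho exprS; lra.
(* Since [w] is not flat for the step [rho n.+1] on [B n], some direction in [B n] raises its norm
   with the full slope. *)
have /choice[g gP] : forall wn : X * nat, exists z, B wn.2 z /\ (wn.1 != 0 ->
    `|wn.1| + eta * rho wn.2.+1 <= `|wn.1 + rho wn.2.+1 *: z|).
  move=> [w n] /=; have [->|w0] := eqVneq w 0.
    by have [z Bz] := B0 n; exists z; split => // /negP[].
  apply: contrapT => hz; apply: h; exists w, (rho n.+1), n; split => // z Bz.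
  by rewrite leNgt; apply/negP => hz'; apply: hz; exists z; split => // _; exact: ltW.
pose u := fix u n := if n is n'.+1 then u n' + rho n *: g (u n', n') else u0.
pose z n := g (u n, n).
have uS n : u n.+1 = u n + rho n.+1 *: z n by [].
have Bz n : B n (z n) by case: (gP (u n, n)).
have wz : weakly_null z by exact: wB.
have u_gt0 n : 0 < `|u n|.
  elim: n => [|n IH]; first by rewrite normr_gt0.
  have [_ /= /(_ _) hz] := gP (u n, n); apply: lt_le_trans (hz _).
    by rewrite addr_gt0// mulr_gt0.
  by rewrite -normr_gt0.
have uz n : `|u n| + eta * rho n.+1 <= `|u n.+1|.
  by have [_ /= hz] := gP (u n, n); apply: hz; rewrite -normr_gt0.
have half1 : `|2^-1 : R| < 1 by rewrite ger0_norm ?invr_ge0//; lra.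
have u_cvg : cvgn u.
  have -> : u = (fun n => u0 + series (fun k => rho k.+1 *: z k) n).
    apply/funext; elim => [|n IH]; first by rewrite /series /= big_geq// addr0.
    by rewrite uS IH /series /= big_nat_recr//= addrA.
  apply: is_cvgD; first exact: is_cvg_cst.
  apply: normed_cvg.
  apply: series_le_cvg (is_cvg_geometric_series (a := C) half1) => n /=.
  - exact: normr_ge0.
  - rewrite mulr_ge0 ?exprn_ge0 ?invr_ge0//.
    by apply: le_trans (bB _ _ (Bz 0%N)).
  rewrite normrZ (ger0_norm (ltW (rho0 _))) mulrC.
  apply: ler_pM => //; [exact: ltW|exact: bB (Bz n)|].
  by rewrite -/(rho n) (rhoS n); have := rho0 n.+1; lra.
have [U uU] := (cvg_ex _).1 u_cvg.
have ugrow n k : `|u n| + eta * (rho n - rho (n + k)%N) <= `|u (n + k)%N|.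
  elim: k => [|k IH]; first by rewrite addn0; lra.
  by move: IH; rewrite addnS (rhoS (n + k)%N); have := uz (n + k)%N; lra.
have near_oo e n : 0 < e -> exists k, `|u (n + k)%N - U| <= e /\ rho (n + k)%N <= e.
  move=> e0; have /cvgn_eventually/(_ _ e0)[N1 h1] : rho @ \oo --> (0 : R).
    have -> : rho = geometric 1 2^-1 by apply/funext => i; rewrite /= mul1r.
    exact: cvg_geometric.
  have /cvgrPdist_le/(_ _ e0)[N2 _ h2] := uU.
  exists (maxn N1 N2).
  have := h1 (n + maxn N1 N2)%N (leq_trans (leq_maxl _ _) (leq_addl _ _)).
  have := h2 (n + maxn N1 N2)%N (leq_trans (leq_maxr _ _) (leq_addl _ _)).
  by rewrite subr0 (ger0_norm (ltW (rho0 _))) distrC.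
have slope n : `|u n| + eta * rho n <= `|U|.
  apply/ler_addgt0Pr => e e0; have ed : 0 < e / (1 + eta) by rewrite divr_gt0//; lra.
  have [k [Uu rk]] := near_oo _ n ed.
  have := ler_normD (u (n + k)%N - U) U; rewrite subrK => tri.
  have := ugrow n k; have := ler_wpM2l (ltW eta0) rk.
  have : e / (1 + eta) + eta * (e / (1 + eta)) = e by field; lra.
  lra.
have [phi [dg gU gle]] := norming_functional U; have [lg _] := dg.
(* From [N] on, [phi] is at most [eta / 2] at each [z n], so it grows along [u] at no more than half
   the rate that [slope] forces on the norm; this is absurd because [phi] norms [U]. *)
have /cvgn_eventually/(_ (eta / 2))[|N zN] := wz phi dg; first by lra.
have gtail k : phi (u (N + k)%N) <= phi (u N) + eta / 2 * (rho N - rho (N + k)%N).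
  elim: k => [|k IH]; first by rewrite addn0; lra.
  rewrite addnS uS functionalD// functionalZ//.
  have := zN (N + k)%N (leq_addr _ _); rewrite subr0 => /(le_trans (ler_norm _)) gz.
  by move: IH; rewrite (rhoS (N + k)%N); have := ler_wpM2l (ltW (rho0 (N + k).+1)) gz; lra.
have e0 : 0 < eta * rho N / 4 by rewrite divr_gt0// mulr_gt0.
have [k [Uu rk]] := near_oo _ N e0.
have := gtail k; have := slope N; rewrite -gU.
have := le_trans (ler_norm _) (gle (u N)).
have := le_trans (ler_norm _) (gle (U - u (N + k)%N)).
rewrite functionalB// distrC.
by have := mulr_gt0 eta0 (rho0 N); have := mulr_gt0 eta0 (rho0 (N + k)%N); lra.
Qed
.

End roughness.

(** The critical value is the infimum of [P]. It serves for distances to hulls, for the number [t]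
    of the key point and for upper limits. *)
Lemma threshold {R : realType} (P : R -> Prop) (a b : R) :
  (forall s t, s <= t -> P s -> P t) -> P b -> ~ P a ->
  exists d, a <= d /\ forall e, 0 < e -> P (d + e) /\ ~ P (d - e).
Proof.
move=> mP Pb nPa.
have aP : lbound P a.
  by move=> s Ps; rewrite leNgt; apply/negP => /ltW sa; apply: nPa; exact: mP sa Ps.
have iP : has_inf P by split; [exists b|exists a].
exists (inf P); split; first by apply: lb_le_inf => //; exists b.
move=> e e0; split.
  by have [s Ps /ltW sd] := inf_adherent e0 iP; exact: mP sd Ps.
move=> Pd; have : inf P <= inf P - e by apply: ge_inf => //; exists a.
by lra.
Qed.

(** * Convex hulls of the tails of a sequence *)

Section tail_hull.
Context {R : realType} {X : normedModType R}.
Implicit Types (S : set X) (x : nat -> X).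

Definition cvx S : Prop := forall (s t : R) (a b : X),
  0 <= s -> 0 <= t -> s + t = 1 -> S a -> S b -> S (s *: a + t *: b).

(** An intersection of convex sets instead of convex combinations: an estimate passes from the
    sequence to the hull by exhibiting one convex set. *)
Definition tail_hull x m : set X :=
  [set c | forall S, cvx S -> (forall j, (m <= j)%N -> S (x j)) -> S c].

Definition hull_diff x m : set X :=
  [set y | exists c c', [/\ tail_hull x m c, tail_hull x m c' & y = c - c']].

Definition weakly_cauchy x : Prop := forall f, dual X f -> cvgn (fun n => f (x n)).

Lemma tail_hull_seq x m j : (m <= j)%N -> tail_hull x m (x j).
Proof. by move=> mj S _; apply. Qed.

Lemma tail_hull_cvx x m : cvx (tail_hull x m).
Proof.
move=> s t a b s0 t0 st Ka Kb S cS xS.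
exact: cS s0 t0 st (Ka _ cS xS) (Kb _ cS xS).
Qed.

Lemma tail_hull_le x m n : (m <= n)%N -> tail_hull x n `<=` tail_hull x m.
Proof.
by move=> mn c Kc S cS xS; apply: Kc => // j nj; apply: xS; exact: (leq_trans mn nj).
Qed.

Lemma hull_diff_le x m n : (m <= n)%N -> hull_diff x n `<=` hull_diff x m.
Proof.
move=> mn y [c [c' [Kc Kc' ->]]]; exists c, c'.
by split => //; [exact: (tail_hull_le mn)|exact: (tail_hull_le mn)].
Qed.

Lemma cvx_functional_ball f (a e : R) : scalar f -> cvx [set c : X | `|f c - a| <= e].
Proof.
move=> lf s t b c s0 t0 st /= fb fc; rewrite (functionalD _ _ lf) !(functionalZ _ _ lf).
have -> : s * f b + t * f c - a = s * (f b - a) + t * (f c - a).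
  by rewrite -{1}(mul1r a) -st; ring.
apply: le_trans (ler_normD _ _) _; rewrite !normrM (ger0_norm s0) (ger0_norm t0).
have -> : e = s * e + t * e by rewrite -mulrDl st mul1r.
by rewrite lerD// ler_wpM2l.
Qed.

Lemma cvx_ball (e : R) : cvx [set c : X | `|c| <= e].
Proof.
move=> s t b c s0 t0 st /= be ce.
apply: le_trans (ler_normD _ _) _; rewrite !normrZ (ger0_norm s0) (ger0_norm t0).
have -> : e = s * e + t * e by rewrite -mulrDl st mul1r.
by rewrite lerD// ler_wpM2l.
Qed.

Lemma tail_hull_norm x m c e : (forall n, `|x n| <= e) -> tail_hull x m c -> `|c| <= e.
Proof. by move=> xe /(_ _ (@cvx_ball e)); apply => j _; exact: xe. Qed.

Lemma hull_diff_norm x m y e : (forall n, `|x n| <= e) -> hull_diff x m y -> `|y| <= e + e.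
Proof.
move=> xe [c [c' [Kc Kc' ->]]]; apply: le_trans (ler_normB _ _) _.
by rewrite lerD//; [exact: tail_hull_norm Kc|exact: tail_hull_norm Kc'].
Qed.

Lemma tail_hull_functional x f (a : R) : dual X f -> f (x n) @[n --> \oo] --> a ->
  forall e, 0 < e -> exists m, forall c, tail_hull x m c -> `|f c - a| <= e.
Proof.
move=> [lf _] /cvgn_eventually fx e /fx[m hm]; exists m => c /(_ _ (@cvx_functional_ball f a e lf)).
by apply => j mj; exact: hm.
Qed.

(** The values of [f] on a far tail hull are all close to one limit, so [f] is small on differences
    of hull points even if [x] has no weak limit. *)
Lemma hull_diff_functional x f : weakly_cauchy x -> dual X f ->
  forall e, 0 < e -> exists m, forall y, hull_diff x m y -> `|f y| <= e.
Proof.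
move=> wx df e e0; have [lf _] := df.
have [a fa] := (cvg_ex _).1 (wx f df).
have e2 : 0 < e / 2 by lra.
have [m hm] := tail_hull_functional df fa e2; exists m => _ [c [c' [/hm Kc /hm Kc' ->]]].
rewrite (functionalB _ _ lf).
have -> : f c - f c' = (f c - a) - (f c' - a) by ring.
by apply: le_trans (ler_normB _ _) _; lra.
Qed.

Lemma weakly_null_hull_diff x : weakly_cauchy x -> weakly_null_sets (hull_diff x).
Proof.
move=> wx y_ By f df; apply/cvgn_eventually => e e0.
have [m hm] := hull_diff_functional wx df e0; exists m => n mn.
by rewrite subr0; apply: hm; exact: hull_diff_le mn _ (By n).
Qed.

End tail_hull.

(** * Trading the bidual limit of [x] for a vector of the space *)

Section key.
Context {R : realType} (X : completeNormedModType R).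
Hypothesis MX : property_M X.
Variable x : nat -> X.
Hypothesis (x1 : forall n, `|x n| <= 1) (wx : weakly_cauchy x).
Let K := tail_hull x.

(** The distances from 0 to the hulls [K m] increase with [m]; their supremum [d] is found as a
    threshold. *)
Lemma asymptotic_hull_norm : exists d, [/\ 0 <= d,
  forall e m, 0 < e -> exists2 c, K m c & `|c| <= d + e &
  forall e, 0 < e -> exists m, forall c, K m c -> d - e <= `|c|].
Proof.
have [|||d [d1 dP]] := @threshold R (fun a => forall m, exists2 c, K m c & `|c| <= a) (-1) 1.
- by move=> s t st h m; have [c Kc cs] := h m; exists c => //; exact: le_trans st.
- by move=> m; exists (x m) => //; exact: tail_hull_seq.
- move=> /(_ 0%N)[c _]; have := normr_ge0 c; lra.
have d0 : 0 <= d.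
  apply/ler_addgt0Pr => e e0; have [/(_ 0%N)[c _ cd] _] := dP _ e0.
  by have := normr_ge0 c; lra.
exists d; split => // [e m e0|e e0]; first by have [] := dP _ e0.
have [_] := dP _ e0; apply: contra_notP => h m.
apply: contrapT => hm; apply: h; exists m => c Kc.
by rewrite leNgt; apply/negP => /ltW cd; apply: hm; exists c.
Qed.

Let B := hull_diff x.

Let property_M_hull (u v : X) (e : R) : 0 < e -> exists m, forall y, B m y ->
  `|u + y| <= `|v + y| + Num.max 0 (`|u| - `|v|) + e.
Proof.
apply: (@property_M_le _ _ (1 + 1)) => //.
- exact: weakly_null_hull_diff.
- by move=> m n mn; exact: hull_diff_le.
- by move=> n y; exact: hull_diff_norm.
Qed.

Let property_M_scaled_hull (r : R) (u v : X) (e : R) : 0 < e -> exists m, forall y, B m y ->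
  `|u + r *: y| <= `|v + r *: y| + Num.max 0 (`|u| - `|v|) + e.
Proof.
move=> e0.
have [|||m hm] := @property_M_le _ _ (`|r| * (1 + 1)) (scale_sets r B) MX _ _ _ u v _ e0.
- exact: weakly_null_scale (weakly_null_hull_diff wx).
- by move=> m n mn _ [y By <-]; exists y => //; exact: hull_diff_le By.
- move=> n _ [y By <-]; rewrite normrZ ler_wpM2l//.
  exact: hull_diff_norm By.
by exists m => y By; apply: hm; exists y.
Qed.

(* (M) and homogeneity transport the flat point of [weakly_null_sets_flat] to
   every vector of norm [d]. *)
Let flat_scale (u0 : X) (d eta : R) : `|u0| = d -> 0 < d -> 0 < eta -> exists2 r, 0 < r &
  forall (u : X) (e : R), 0 < e -> exists m, forall z, B m z ->
    `|u + r *: z| <= d + eta * r + Num.max 0 (`|u| - d) + e.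
Proof.
move=> u0d d0 eta0.
have u00 : u0 != 0 by rewrite -normr_gt0 u0d.
have B0 n : B n !=set0.
  by exists (x n - x n), (x n), (x n); split => //; exact: tail_hull_seq.
have bB n y : B n y -> `|y| <= 1 + 1 by exact: hull_diff_norm.
have [w [r [m [w0 r0 wr]]]] :=
  weakly_null_sets_flat (weakly_null_hull_diff wx) B0 bB u00 eta0.
have nw : 0 < `|w| by rewrite normr_gt0.
pose s := d / `|w|; have s0 : 0 < s by rewrite divr_gt0.
have nsw : `|s *: w| = d by rewrite normrZ (ger0_norm (ltW s0)) /s mulfVK// gt_eqF.
(* Scaling the flat point [w] to norm [d] multiplies the step by [s] and keeps the slope [eta]. *)
exists (s * r); first exact: mulr_gt0.
move=> u e e0; have [m' um'] := property_M_scaled_hull (s * r) u (s *: w) e0.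
exists (maxn m m') => z Bz.
have := um' _ (hull_diff_le (leq_maxr _ _) Bz); rewrite nsw => /le_trans; apply.
have := wr _ (hull_diff_le (leq_maxl _ _) Bz).
rewrite -(ler_pM2l s0) -[s in leLHS](ger0_norm (ltW s0)) -normrZ scalerDr scalerA.
have -> : s * (`|w| + eta * r) = d + eta * (s * r).
  by rewrite /s; field; rewrite gt_eqF.
by lra.
Qed.

(* The proof of the key point, in the notation of the header, with [de] for the
   error of each approximation. *)
Lemma hull_translate_sphere u d : `|u| = d -> 0 < d ->
  (forall e m, 0 < e -> exists2 c, K m c & `|c| <= d + e) ->
  (forall e, 0 < e -> exists m, forall c, K m c -> d - e <= `|c|) ->
  forall e m, 0 < e -> exists2 D, K m D &
    exists N, forall n, (N <= n)%N -> `|u - D + x n| <= 1 + e.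
Proof.
move=> ud d0 dup dlow.
(* The threshold of [P] is the [t] of the header; the claim amounts to [t <= 1]. *)
pose P a := forall m, exists2 D, K m D &
  exists N, forall n, (N <= n)%N -> `|u - D + x n| <= a.
have mP s t : s <= t -> P s -> P t.
  move=> st Ps m; have [D KD [N hN]] := Ps m; exists D => //; exists N => n /hN.
  by move=> /le_trans; exact.
have [||t [_ tP]] := @threshold R P (-1) (d + 1 + 1) mP.
- move=> m; exists (x m); first exact: tail_hull_seq.
  exists 0%N => n _; apply: le_trans (ler_normD _ _) _; apply: lerD => //.
  by apply: le_trans (ler_normB _ _) _; rewrite ud lerD.
- move=> /(_ 0%N)[D _ [N /(_ N (leqnn _))]].
  by have := normr_ge0 (u - D + x N); lra.
have [t1|t1] := leP t 1.
  by move=> e m e0; apply: (mP (t + e)); [lra|have [] := tP _ e0].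
exfalso.
(* Half of the slope that [t > 1] would force, which leaves room for the errors. *)
pose eta := (t - 1) / 2; have eta0 : 0 < eta by rewrite /eta; lra.
have [r r0 rP] := flat_scale ud d0 eta0.
(* Multiplied by [1 + r], the bound in [step2] amounts to [(7 + 3 * r) * de <= r * (t - 1 - eta) = r
   * eta]; this [de] makes the left side half of the right one. *)
pose de := r * eta / (2 * (7 + 3 * r)).
have de0 : 0 < de by rewrite divr_gt0 ?mulr_gt0//; lra.
have deE : (7 + 3 * r) * de = r * eta / 2 by rewrite /de; field; lra.
have [m1 lowK] := dlow _ de0.
have [m1' low_t] : exists m, forall D, K m D ->
    ~ exists N, forall n, (N <= n)%N -> `|u - D + x n| <= t - de.
  apply: contrapT => h; have [_] := tP _ de0; apply => m.
  apply: contrapT => hm; apply: h; exists m => D KD hD; apply: hm.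
  by exists D.
(* [C] has nearly minimal norm, [C'] and [D'] lie where the norm is flat at [C], and [D] is chosen
   last, nearly optimal for [t]. *)
have [C KC Cd] := dup _ m1 de0.
have [m2 flatC] := rP C _ de0.
pose C' := x (maxn m1 m2).
pose al := (1 + r)^-1.
have al0 : 0 < al by rewrite invr_gt0; lra.
have alr0 : 0 < al * r by rewrite mulr_gt0.
have alr : al + al * r = 1 by rewrite /al; field; lra.
pose C2 := al *: C + (al * r) *: C'.
have KC2 : K m1 C2.
  apply: tail_hull_cvx => //; [exact: ltW|by rewrite mulr_ge0 ?ltW| ].
  by apply: tail_hull_seq; exact: leq_maxl.
have [m3 cmp_u_C2] := property_M_hull u C2 de0.
have := lowK _ KC2 => C2d.
have [M3 [m1M3 m2M3 m3M3]] : exists M3, [/\ (m1' <= M3)%N, (m2 <= M3)%N & (m3 <= M3)%N].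
  by exists (maxn m1' (maxn m2 m3)); rewrite !leq_max !leqnn !orbT.
pose D' := x M3.
pose w := C + r *: (C' - D').
have wd : `|w| <= d + eta * r + 2 * de.
  have Bz : B m2 (C' - D').
    exists C', D'; split => //; apply: tail_hull_seq; first exact: leq_maxr.
    exact: m2M3.
  have := flatC _ Bz; rewrite -/w => /le_trans; apply.
  have : Num.max 0 (`|C| - d) <= de by rewrite ge_max; lra.
  by lra.
have [m4 cmp_w_u] := property_M_hull w u de0.
have [/(_ (maxn M3 m4))[D KD [N hN]] _] := tP _ de0.
pose D2 := al *: D + (al * r) *: D'.
have KD2 : K M3 D2.
  apply: tail_hull_cvx => //; [exact: ltW|by rewrite mulr_ge0 ?ltW| |].
    exact: tail_hull_le (leq_maxl _ _) _ KD.
  exact: tail_hull_seq.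
have M3m1 : K m1' D2 by exact: tail_hull_le m1M3 _ KD2.
apply: (low_t D2 M3m1).
exists (maxn N (maxn M3 m4)) => n; rewrite !geq_max => /and3P[Nn M3n m4n].
have By : B m4 (x n - D).
  exists (x n), D; split => //; first exact: tail_hull_seq.
  exact: tail_hull_le (leq_maxr _ _) _ KD.
have By2 : B m3 (x n - D2).
  exists (x n), D2; split => //.
    by apply: tail_hull_seq; exact: leq_trans M3n.
  exact: tail_hull_le m3M3 _ KD2.
(* By (M), replacing [u] by [w] costs at most the excess of |w| over [d], up to [de]. *)
have step1 : `|w - D + x n| <= t + eta * r + 4 * de.
  have := cmp_w_u _ By; rewrite !(addrC (x n)) !addrA => /le_trans; apply.
  have := hN n Nn.
  have : Num.max 0 (`|w| - `|u|) <= eta * r + 2 * de.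
    by rewrite ge_max ud; have := mulr_gt0 eta0 r0; lra.
  by lra.
(* The middle point is a convex combination of [w - D + x n] and of [x n], whose norm is at most
   [1 < t]. *)
have step2 : `|C2 - D2 + x n| <= t - 3 * de.
  have -> : C2 - D2 + x n = al *: (w - D + x n) + (al * r) *: x n.
    rewrite /w (addrAC C) (scalerDr al _ (x n)) (scalerDr al (C - D)) scalerA.
    rewrite -[RHS]addrA -scalerDl alr scale1r /C2 /D2 opprD addrACA.
    by rewrite -!scalerBr.
  apply: le_trans (ler_normD _ _) _.
  rewrite !normrZ (ger0_norm (ltW al0)) (ger0_norm (ltW r0)).
  have h1 := ler_wpM2l (ltW al0) step1.
  have h2 : al * r * `|x n| <= al * r by rewrite ler_piMr// ltW.
  suff : al * (t + eta * r + 4 * de + r) <= t - 3 * de by lra.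
  rewrite mulrC ler_pdivrMr; last lra.
  by have := mulr_gt0 r0 eta0; rewrite /eta in deE *; lra.
(* Return from [C2] to [u]: as [C2] is in [K m1], its norm is at least [d - de], so at most [2 * de]
   is lost and [low_t] is contradicted. *)
have := cmp_u_C2 _ By2; rewrite !(addrC (x n)) !addrA => /le_trans; apply.
have : Num.max 0 (`|u| - `|C2|) <= de by rewrite ge_max ud; lra.
by lra.
Qed.

(* [d] is the distance from 0 to the weak* limit of [x] in the bidual. *)
Lemma hull_translate : exists d, [/\ 0 <= d, exists v : X, `|v| = d,
  forall f a, dual X f -> f (x n) @[n --> \oo] --> a -> a <= dual_norm f * d &
  forall (u : X) (e : R) m, `|u| <= d -> 0 < e -> exists2 D, K m D &
    exists N, forall n, (N <= n)%N -> `|u - D + x n| <= 1 + e].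
Proof.
have [d [d0 dup dlow]] := asymptotic_hull_norm; exists d.
have [v vd] : exists v : X, `|v| = d.
  move: d0; rewrite le_eqVlt => /predU1P[<-|d0]; first by exists 0; rewrite normr0.
  have [|m1 m1P] := dlow (d / 2); first by lra.
  have nx : 0 < `|x m1| by have := m1P _ (@tail_hull_seq _ _ x _ _ (leqnn m1)); lra.
  exists ((d / `|x m1|) *: x m1).
  by rewrite normrZ ger0_norm ?divr_ge0 ?ltW// mulfVK// gt_eqF.
split => //; first by exists v.
  move=> f a df fa; have F0 := dual_norm_ge0 df.
  apply/ler_addgt0Pr => e e0.
  have ed : 0 < e / (2 + dual_norm f) by rewrite divr_gt0//; lra.
  have [m fm] := tail_hull_functional df fa ed.
  have [c Kc cd] := dup _ m ed.
  have := fm c Kc; rewrite distrC => /(le_trans (ler_norm _)) h1.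
  have h2 := le_trans (ler_norm _) (dual_norm_bound c df).
  have h3 := ler_wpM2l F0 cd.
  have : (2 + dual_norm f) * (e / (2 + dual_norm f)) = e by field; lra.
  by lra.
move=> u e m ud e0; have e2 : 0 < e / 2 by lra.
(* For [d = 0] the vector [u] vanishes and a hull point [D] of small norm suffices. *)
move: d0; rewrite le_eqVlt => /predU1P[d0|d0].
  have [D KD Dd] := dup _ m e0; exists D => //; exists 0%N => n _.
  have -> : u = 0 by apply/eqP; rewrite -normr_le0 d0.
  rewrite sub0r; apply: le_trans (ler_normD _ _) _.
  by rewrite normrN; have := x1 n; lra.
(* On far hull differences a vector [u] of norm at most [d] does no worse than [v] on the sphere, up
   to [e / 2]. *)
have [m2 m2P] := property_M_hull u v e2.
have [D KD [N hN]] := hull_translate_sphere vd d0 dup dlow (maxn m m2) e2.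
exists D; first exact: tail_hull_le (leq_maxl _ _) _ KD.
exists (maxn N m2) => n; rewrite geq_max => /andP[Nn m2n].
have By : B m2 (x n - D).
  exists (x n), D; split => //; first exact: tail_hull_seq.
  exact: tail_hull_le (leq_maxr _ _) _ KD.
have := m2P _ By; rewrite !(addrC (x n)) !addrA => /le_trans; apply.
have -> : Num.max 0 (`|u| - `|v|) = 0 by apply/max_idPl; rewrite vd; lra.
by have := hN n Nn; lra.
Qed.

End key.

(** * Rosenthal's dichotomy between oscillation and independence *)

Section independence.
Context {T : Type} (side : bool -> nat -> set T).
Implicit Types (M : set nat) (E : set T) (s : T).

Definition unbounded M : Prop := forall N, exists2 n, (N <= n)%N & M n.

Definition alternates s M : Prop := forall b, unbounded (M `&` [set n | side b n s]).

(** When this fails, some infinite subset of [M] admits no oscillating member of [E]; when it holds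
    on an infinite [M], [rich_independent] applies. *)
Definition rich E M : Prop := forall M', M' `<=` M -> unbounded M' ->
  exists2 s, E s & alternates s M'.

Lemma alternates_tail s M M' N : (forall n, (N <= n)%N -> M n -> M' n) ->
  alternates s M -> alternates s M'.
Proof.
move=> MM' sM b K; have [n] := sM b (maxn K N).
rewrite geq_max => /andP[Kn Nn] [Mn sn]; exists n => //; split => //.
exact: MM'.
Qed.

Lemma pigeonhole_unbounded (I : finType) (l : nat -> I) :
  exists i, unbounded [set k | l k = i].
Proof.
apply: contrapT => h.
have /choice[N hN] : forall i, exists N, forall k, (N <= k)%N -> l k <> i.
  move=> i; apply: contrapT => hi; apply: h; exists i => N.
  apply: contrapT => hN; apply: hi; exists N => k Nk lk; apply: hN.
  by exists k.
by apply: (hN (l (\max_i N i)) (\max_i N i)) => //; exact: leq_bigmax.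
Qed.

(* Rosenthal's splitting step: if every choice of [n] failed on a further
   subset, a diagonal sequence of failing [n]'s, all failing for the same
   member and side, would itself contradict richness. *)
Lemma rich_split (I : finType) (E : I -> set T) M :
  unbounded M -> (forall i, rich (E i) M) ->
  exists n M', [/\ M' `<=` M, unbounded M' &
    forall i b, rich (E i `&` side b n) M'].
Proof.
move=> uM rE; apply: contrapT => h.
(* Within [st.1], [r] records an index not before [st.2], a smaller infinite set, and a member and
   side for which nothing alternates on that set. *)
pose fails (st : set nat * nat) (r : nat * set nat * (I * bool)) :=
  [/\ st.1 r.1.1, (st.2 <= r.1.1)%N, r.1.2 `<=` st.1, unbounded r.1.2 &
    forall s, E r.2.1 s -> side r.2.2 r.1.1 s -> ~ alternates s r.1.2].
have bad n M' : M' `<=` M -> unbounded M' -> exists i b, ~ rich (E i `&` side b n) M'.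
  move=> M'M uM'; apply: contrapT => hb; apply: h; exists n, M'; split => // i b.
  by apply: contrapT => hr; apply: hb; exists i, b.
have [i0 _] := bad 0%N M (fun _ => id) uM.
have /choice[g gP] : forall st, exists r,
    st.1 `<=` M -> unbounded st.1 -> fails st r.
  move=> [M1 l]; have [[M1M uM1]|M1bad] := pselect (M1 `<=` M /\ unbounded M1); last first.
    by exists (0%N, set0, (i0, true)) => *; exfalso; apply: M1bad.
  have [n ln M1n] := uM1 l.
  have [i [b /existsNP[M2 /not_implyP[M21 /not_implyP[uM2 noalt]]]]] := bad n M1 M1M uM1.
  exists (n, M2, (i, b)) => _ _; split => //= s Es sb alt; apply: noalt.
  by exists s.
pose st := fix st k := if k is k'.+1 then
  let r := g (st k') in (r.1.2, r.1.1.+1) else (M, 0%N).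
pose n k := (g (st k)).1.1.
have stS k : st k.+1 = ((g (st k)).1.2, (n k).+1) by [].
have st_ok k : (st k).1 `<=` M /\ unbounded (st k).1.
  elim: k => [|k [kM uk]]; first by split => // ?. rewrite stS /=.
  by have [_ _ sub uS _] := gP _ kM uk; split => //; exact: subset_trans kM.
have stP k : fails (st k) (g (st k)) by have [? ?] := st_ok k; exact: gP.
have st_sub j k : (j <= k)%N -> (st k).1 `<=` (st j).1.
  move=> /subnK <-; elim: (k - j)%N => [?|i IH]; [by []|rewrite addSn stS /=].
  by have [_ _ sub _ _] := stP (i + j)%N; exact: subset_trans IH.
have n_incr j k : (j < k)%N -> (n j < n k)%N.
  elim: k => [//|k IH]; rewrite ltnS leq_eqVlt => /predU1P[->|/IH jk].
    by have [_ + _ _ _] := stP k.+1; rewrite stS.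
  by apply: ltn_trans jk _; have [_ + _ _ _] := stP k.+1; rewrite stS.
have n_ge k : (k <= n k)%N.
  by elim: k => [//|k IH]; apply: leq_ltn_trans IH _; exact: n_incr.
have [[i b] ui] := pigeonhole_unbounded (fun k => (g (st k)).2).
pose N := [set m | exists2 k, (g (st k)).2 = (i, b) & m = n k].
have NM : N `<=` M by move=> _ [k _ ->]; have [+ _ _ _ _] := stP k; apply: (st_ok k).1.
have uN : unbounded N.
  by move=> K; have [k Kk gk] := ui K; exists (n k); [exact: leq_trans (n_ge k)|exists k].
(* Some [s] alternates on the diagonal set [N], so it lies on side [b] at some [n k]; beyond [n k],
   [N] is inside the set recorded at stage [k], where such an [s] cannot alternate. *)
have [s Es alt] := rE i N NM uN.
have [_ _ [[k gk ->] sk]] := alt b 0%N.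
have [_ _ _ _ noalt] := stP k; rewrite gk in noalt; apply: (noalt s Es sk).
apply: (alternates_tail (N := (n k).+1)) alt => m nm [j gj mj]; subst m.
have kj : (k < j)%N.
  rewrite ltnNge leq_eqVlt; apply/negP => /predU1P[jk|/n_incr jk].
    by rewrite jk ltnn in nm.
  by have := ltn_trans jk nm; rewrite ltnn.
by apply: (st_sub k.+1 j kj); have [+ _ _ _ _] := stP j.
Qed.

(* A stage records the nonempty intersections already secured, indexed by a
   finite type, the last index chosen, and an infinite set of indices on which
   these intersections are still rich. *)
Let stage := ({I : finType & I -> set T} * (nat * set nat))%type.

Let stage_ok (st : stage) : Prop :=
  unbounded st.2.2 /\ forall i, rich (projT2 st.1 i) st.2.2.

(** Each split intersects the whole family with both sides at the new index; the resulting sets are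
    rich, hence nonempty. *)
Lemma rich_independent E M : unbounded M -> rich E M ->
  exists n_ : nat -> nat, forall (sg : nat -> bool) k,
    exists2 s, E s & forall j, (j < k)%N -> side (sg j) (n_ j) s.
Proof.
move=> uM rE.
have /choice[g gP] : forall st : stage, exists st' : stage, stage_ok st ->
    stage_ok st' /\ forall i b, exists i',
      projT2 st'.1 i' `<=` projT2 st.1 i `&` side b st'.2.1.
  move=> [[I F] [n0 M0]];
  have [[uM0 rF]|] := pselect (stage_ok (existT _ I F, (n0, M0))); last first.
    by move=> nok; exists (existT _ I F, (n0, M0)).
  have [n [M' [M'M uM' rF']]] := rich_split uM0 rF.
  exists (existT (fun I : finType => I -> set T) (I * bool)%type
    (fun ib => F ib.1 `&` side ib.2 n), (n, M')) => _ /=.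
  split; first by split => //= -[i b]; exact: rF'.
  by move=> i b; exists (i, b).
pose st := fix st k := if k is k'.+1 then g (st k') else
  (existT (fun I : finType => I -> set T) unit (fun=> E), (0%N, M)) : stage.
have st_ok k : stage_ok (st k).
  by elim: k => [//|k IH]; exact: (gP _ IH).1.
exists (fun k => (st k.+1).2.1) => sg k.
have [i iP] : exists i, projT2 (st k).1 i `<=`
    [set s | E s /\ forall j, (j < k)%N -> side (sg j) (st j.+1).2.1 s].
  elim: k => [|k [i IH]]; first by exists tt => s Es; split.
  have [i' i'P] := (gP _ (st_ok k)).2 i (sg k); exists i' => s /i'P[/IH[Es sj] sk].
  split => // j; rewrite ltnS leq_eqVlt => /predU1P[->//|]; exact: sj.
have [uk rk] := st_ok k.
have [s /iP[Es sj] _] := rk i _ (fun _ => id) uk.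
by exists s.
Qed.

End independence.

(** * Sequences equivalent to the unit vector basis of l1 *)

Section ell1_embedding.
Context {R : realType} (X : completeNormedModType R).
Implicit Types a b : nat -> R.

Lemma ell1_partial a k : ell1 a -> \sum_(0 <= i < k) `|a i| <= ell1_norm a.
Proof.
move=> la; apply: (nondecreasing_cvgn_le _ la k).
by apply: nondecreasing_series => n _ _; exact: normr_ge0.
Qed.

Lemma ell1_norm_le a (C : R) : (forall k, \sum_(0 <= i < k) `|a i| <= C) ->
  ell1 a /\ ell1_norm a <= C.
Proof.
move=> aC; have la : ell1 a.
  apply: nondecreasing_is_cvgn; last by exists C => _ [k _ <-]; exact: aC.
  by apply: nondecreasing_series => n _ _; exact: normr_ge0.
by split => //; apply: limr_le => //; apply: nearW => k; exact: aC.
Qed.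

Lemma ell1_coord a n : ell1 a -> `|a n| <= ell1_norm a.
Proof.
move=> /(ell1_partial n.+1); apply: le_trans.
by rewrite big_nat_recr//= ler_wpDl// sumr_ge0.
Qed.

Lemma ell1_lin (r : R) a b : ell1 a -> ell1 b ->
  ell1 (fun n => r * a n + b n) /\
  ell1_norm (fun n => r * a n + b n) <= `|r| * ell1_norm a + ell1_norm b.
Proof.
move=> la lb; apply: ell1_norm_le => k.
apply: (@le_trans _ _ (\sum_(0 <= i < k) (`|r| * `|a i| + `|b i|))).
  by apply: ler_sum => i _; rewrite -normrM; exact: ler_normD.
rewrite big_split -mulr_sumr /=; apply: lerD; last exact: ell1_partial.
by rewrite ler_wpM2l//; exact: ell1_partial.
Qed.

Variables (y : nat -> X) (de : R).
Hypotheses (y1 : forall n, `|y n| <= 1) (de0 : 0 < de).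
Hypothesis y_ell1 : forall a k,
  de * \sum_(0 <= i < k) `|a i| <= `|\sum_(0 <= i < k) a i *: y i|.

Definition ell1_op a : X := limn (series (fun n => a n *: y n)).

Lemma ell1_op_cvg a : ell1 a ->
  series (fun n => a n *: y n) @ \oo --> ell1_op a.
Proof.
move=> la; apply: normed_cvg; apply: series_le_cvg la => n //=.
by rewrite normrZ ler_piMr.
Qed.

Lemma ell1_op_lin (r : R) a b : ell1 a -> ell1 b ->
  ell1_op (fun n => r * a n + b n) = r *: ell1_op a + ell1_op b.
Proof.
move=> la lb; apply: cvg_lim => //.
rewrite (_ : series _ = (fun k =>
    r *: series (fun n => a n *: y n) k + series (fun n => b n *: y n) k)).
  apply: cvgD; last exact: ell1_op_cvg.
  by apply: cvgZr; exact: ell1_op_cvg.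
apply/funext => k; rewrite /series /= scaler_sumr -big_split /=.
by apply: eq_bigr => i _; rewrite scalerDl scalerA.
Qed.

Lemma ell1_op_cvg_norm a : ell1 a ->
  `|\sum_(0 <= i < k) a i *: y i| @[k --> \oo] --> `|ell1_op a|.
Proof. by move=> la; apply: cvg_norm; exact: ell1_op_cvg. Qed.

Lemma ell1_op_le a : ell1 a -> `|ell1_op a| <= ell1_norm a.
Proof.
move=> la; apply: (cvgn_le (N := 0%N) (ell1_op_cvg_norm la)) => k _.
apply: le_trans (ell1_partial k la).
apply: le_trans (ler_norm_sum _ _ _) _; apply: ler_sum => i _.
by rewrite normrZ ler_piMr.
Qed.

Lemma ell1_op_ge a : ell1 a -> de * ell1_norm a <= `|ell1_op a|.
Proof.
move=> la; rewrite mulrC -ler_pdivlMr//; apply: (ell1_norm_le _).2 => k.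
rewrite ler_pdivlMr// mulrC.
apply: (cvgn_ge (N := k) (ell1_op_cvg_norm la)) => j kj.
apply: le_trans (y_ell1 a j); rewrite ler_pM2l// (big_cat_nat _ kj)//=.
by rewrite lerDl sumr_ge0.
Qed.

Lemma ell1_sub a b : ell1 a -> ell1 b -> ell1 (fun n => a n - b n) /\
  ell1_op (fun n => a n - b n) = ell1_op a - ell1_op b.
Proof.
move=> la lb; have -> : (fun n => a n - b n) = (fun n => -1 * b n + a n).
  by apply/funext => n; ring.
have [lc _] := ell1_lin (-1) lb la; split => //.
by rewrite ell1_op_lin// scaleN1r addrC.
Qed.

(** By the lower estimate [ell1_op_ge], preimages of an approximating sequence are Cauchy in the
    l1-norm; their coordinatewise limit is mapped to the given point. *)
Lemma ell1_op_closed : closed (ell1_op @` ell1).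
Proof.
move=> z zcl.
have harm0 : (harmonic : nat -> R) @ \oo --> (0 : R) by exact: cvg_harmonic.
have /choice[a_ aP] : forall k, exists a, ell1 a /\ `|ell1_op a - z| <= harmonic k.
  move=> k; have [_ [[a la <-] za]] := zcl _ (nbhsx_ballx z _ (@harmonic_gt0 R k)).
  exists a; split => //; move: za; rewrite -ball_normE /= distrC; exact: ltW.
have dist k l : ell1 (fun n => a_ k n - a_ l n) /\
    ell1_norm (fun n => a_ k n - a_ l n) <= de^-1 * (harmonic k + harmonic l).
  have [lak ak] := aP k; have [lal al] := aP l.
  have [lkl kl] := ell1_sub lak lal; split => //.
  rewrite ler_pdivlMl//; apply: le_trans (ell1_op_ge lkl) _; rewrite kl.
  rewrite -(subrK z (ell1_op (a_ k))) -addrA; apply: le_trans (ler_normD _ _) _.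
  by rewrite lerD// distrC.
have harm_small e : 0 < e -> exists N, forall n, (N <= n)%N -> de^-1 * harmonic n <= e.
  move=> e0; have [|N hN] := (cvgn_eventually _ _).1 harm0 (de * e); first exact: mulr_gt0.
  exists N => n /hN; rewrite subr0 (ger0_norm (ltW (harmonic_gt0 n))).
  by rewrite ler_pdivrMl.
have coord_cvg n : cvgn (fun k => a_ k n).
  apply/cauchy_cvgP/cauchy_exP => e e0.
  have [|N hN] := harm_small (e / 4); first lra.
  exists (a_ N n); exists N => // k /= Nk; rewrite -ball_normE /=.
  have [lNk Nk_le] := dist N k; have := ell1_coord n lNk.
  by have := hN k Nk; have := hN N (leqnn N); rewrite mulrDr in Nk_le; lra.
pose a n := limn (fun k => a_ k n).
(* Finite partial sums survive the limit in [l], so the Cauchy estimate passes to the coordinatewise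
   limit. *)
have tail k : ell1 (fun n => a_ k n - a n) /\
    ell1_norm (fun n => a_ k n - a n) <= de^-1 * harmonic k.
  apply: ell1_norm_le => K.
  have cv : \sum_(0 <= i < K) `|a_ k i - a_ l i| @[l --> \oo] -->
      \sum_(0 <= i < K) `|a_ k i - a i|.
    apply: cvg_big => [|i _]; first exact: add_continuous.
    by apply: cvg_norm; apply: cvgB; [exact: cvg_cst|exact: coord_cvg].
  apply/ler_addgt0Pr => e /harm_small[N hN].
  apply: (cvgn_le (N := N) cv) => l Nl; have [lkl kl] := dist k l.
  apply: le_trans (ell1_partial K lkl) _; apply: le_trans kl _.
  by rewrite mulrDr lerD2l; exact: hN.
have la : ell1 a.
  have -> : a = (fun n => a_ 0%N n - (a_ 0%N n - a n)) by apply/funext => n; ring.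
  by apply: (ell1_sub _ _).1; [exact: (aP 0%N).1|exact: (tail 0%N).1].
exists a => //; apply/eqP; rewrite -subr_eq0 -normr_le0; apply/ler_addgt0Pr => e e0.
rewrite add0r.
have [|N hN] := harm_small (e / 2); first lra.
have [|N' hN'] := (cvgn_eventually _ _).1 harm0 (e / 2); first lra.
pose k := maxn N N'.
have [lka ka] := tail k; have [lak ak] := aP k.
have := ell1_op_le lka; rewrite (ell1_sub lak la).2 distrC => h1.
rewrite -(subrK (ell1_op (a_ k)) (ell1_op a)) -addrA.
apply: le_trans (ler_normD _ _) _.
have := hN k (leq_maxl _ _); have := hN' k (leq_maxr _ _).
by rewrite subr0 (ger0_norm (ltW (harmonic_gt0 k))); lra.
Qed.

Lemma contains_copy_of_ell1_seq : contains_copy_of_ell1 X.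
Proof.
exists (ell1_op @` ell1).
  split; first exact: ell1_op_closed.
    have [l0 _] : ell1 (fun=> 0 : R) /\ ell1_norm (fun=> 0 : R) <= 0.
      by apply: ell1_norm_le => k; rewrite big1// => i _; rewrite normr0.
    exists (fun=> 0) => //; apply/eqP; rewrite -normr_le0.
    apply: le_trans (ell1_op_le l0) _; apply: (ell1_norm_le _).2 => k.
    by rewrite big1// => i _; rewrite normr0.
  move=> r _ _ [a la <-] [b lb <-]; exists (fun n => r * a n + b n).
    exact: (ell1_lin _ _ _).1.
  exact: ell1_op_lin.
exists ell1_op; split.
- split; [by move=> a la; exists a| |by move=> _ [a la <-]; exists a].
  move=> a b /set_mem la /set_mem lb ab; apply/funext => n; apply/eqP.
  have [lc cE] := ell1_sub la lb.
  rewrite -subr_eq0 -normr_le0; apply: le_trans (ell1_coord n lc) _.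
  by have := ell1_op_ge lc; rewrite cE ab subrr normr0 pmulr_rle0.
- exact: ell1_op_lin.
- by exists 1 => a la; rewrite mul1r; exact: ell1_op_le.
- by exists de^-1 => a la; rewrite ler_pdivlMl//; exact: ell1_op_ge.
Qed.

End ell1_embedding.

(** * Rosenthal's l1 theorem *)

Section rosenthal.
Context {R : realType} (X : completeNormedModType R).

(** The threshold [d] is the upper limit; values recurring below [d - e] would give an oscillation
    across two rationals between [d - e] and [d]. Rationals keep the conditions countable for the
    diagonal argument. *)
Lemma cvgn_no_oscillation (u : nat -> R) (C : R) : (forall n, `|u n| <= C) ->
  (forall p q : rat, p < q ->
    ~ (unbounded [set n | ratr q <= u n] /\ unbounded [set n | u n <= ratr p])) ->
  cvgn u.
Proof.
move=> uC osc.
pose P a := exists N, forall n, (N <= n)%N -> u n <= a.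
have mP s t : s <= t -> P s -> P t.
  by move=> st [N hN]; exists N => n /hN /le_trans; apply.
have [||d [_ dP]] := @threshold R P (- C - 1) C mP.
- by exists 0%N => n _; apply: le_trans (uC n); exact: ler_norm.
- move=> [N /(_ N (leqnn N))].
  by have := uC N; rewrite ler_norml => /andP[]; lra.
apply/cvg_ex; exists d; apply/cvgn_eventually => e e0.
have [[N1 hN1] _] := dP e e0.
have [[N2 hN2]|nP] := pselect (exists N, forall n, (N <= n)%N -> d - e <= u n).
  exists (maxn N1 N2) => n; rewrite geq_max => /andP[/hN1 ? /hN2 ?].
  by rewrite ler_norml; lra.
exfalso.
have de2 : d - e < d - e / 2 by lra.
have [p] := rat_in_itvoo de2; rewrite in_itv /= => /andP[ep pd].
have dlt : d - e / 2 < d by lra.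
have [q] := rat_in_itvoo dlt; rewrite in_itv /= => /andP[eq qd].
apply: (osc p q); first by rewrite -(ltr_rat R); lra.
split => N.
  have dq : 0 < d - ratr q by lra.
  have [_ nPq] := dP _ dq; apply: contrapT => h; apply: nPq; exists N => n Nn.
  rewrite subKr leNgt; apply/negP => /ltW qu; apply: h.
  by exists n.
apply: contrapT => h; apply: nP; exists N => n Nn.
rewrite leNgt; apply/negP => und; apply: h; exists n => //=.
by lra.
Qed.

Variable x : nat -> X.
Hypothesis x1 : forall n, `|x n| <= 1.

Let ball : set (X -> R) := [set f | dual X f /\ forall z, `|f z| <= `|z|].

Let side (p q : R) (b : bool) (n : nat) : set (X -> R) :=
  if b then [set f | q <= f (x n)] else [set f | f (x n) <= p].

(** Functionals [f] and [g] realizing the signs of [a] and the opposite ones differ at [z] by at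
    least [q - p] times the sum of the |a_i|, and by at most 2|z|. *)
Lemma rich_contains_ell1 (p q : R) M : p < q -> unbounded M ->
  rich (side p q) ball M -> contains_copy_of_ell1 X.
Proof.
move=> pq uM /(rich_independent uM)[n_ indep].
pose de := (q - p) / 2; have de0 : 0 < de by rewrite /de; lra.
apply: (@contains_copy_of_ell1_seq _ _ (x \o n_) de) => //= a k.
have [f [df fle] fP] := indep (fun i => 0 <= a i) k.
have [g [dg gle] gP] := indep (fun i => ~~ (0 <= a i)) k.
have [lf _] := df; have [lg _] := dg.
pose z := \sum_(0 <= i < k) a i *: x (n_ i).
have sum_fun h : scalar h -> h z = \sum_(0 <= i < k) a i * h (x (n_ i)).
  move=> lh; rewrite /z; elim: k {fP gP z} => [|k IH].
    by rewrite !big_geq// functional0.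
  by rewrite !big_nat_recr//= (functionalD _ _ lh) IH (functionalZ _ _ lh).
have : 2 * (de * \sum_(0 <= i < k) `|a i|) <= f z - g z.
  rewrite !sum_fun// -sumrB mulrA mulr_sumr !big_nat; apply: ler_sum => i ik.
  rewrite -mulrBr /de; have := fP i ik; have := gP i ik; rewrite /side.
  case: (leP 0 (a i)) => ai /= gi fi.
    rewrite (ger0_norm ai) mulrC ler_wpM2l//; lra.
  by rewrite (ltr0_norm ai); nra.
have := le_trans (ler_norm _) (fle z); have := le_trans (ler_norm _) (gle (- z)).
rewrite functionalN// normrN -/z.
by lra.
Qed.

(** Without richness, an infinite set of indices can be thinned so that no functional of the dual
    ball oscillates across a given rational pair; a diagonal sequence handles all pairs. *)
Lemma rosenthal_l1 : ~ contains_copy_of_ell1 X ->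
  exists2 phi : nat -> nat, forall n, (phi n < phi n.+1)%N & weakly_cauchy (x \o phi).
Proof.
move=> nol1.
(* [None] stands for an index coding no pair, which imposes no condition. *)
have thin (pq : option (rat * rat)) M : unbounded M -> exists M', [/\ M' `<=` M, unbounded M' &
    if pq is Some (p, q) then
      p < q -> forall f, ball f -> ~ alternates (side (ratr p) (ratr q)) f M'
    else True].
  move=> uM; case: pq => [[p q]|]; last by exists M; split.
  have [pq|pq] := pselect (p < q); last by exists M; split.
  have nr : ~ rich (side (ratr p) (ratr q)) ball M.
    move=> rM; apply: nol1; apply: rich_contains_ell1 uM rM.
    by rewrite ltr_rat.
  have {nr}/existsNP[M' /not_implyP[M'M /not_implyP[uM' h]]] := nr.
  exists M'; split => // _ f Sf alt; apply: h; by exists f.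
have /choice[g gP] : forall kM : nat * set nat, exists M', unbounded kM.2 ->
    [/\ M' `<=` kM.2, unbounded M' &
    if (unpickle kM.1 : option (rat * rat)) is Some (p, q) then
      p < q -> forall f, ball f -> ~ alternates (side (ratr p) (ratr q)) f M'
    else True].
  move=> [k M]; have [uM|nuM] := pselect (unbounded M); last by exists M.
  by have [M' M'P] := thin (unpickle k) M uM; exists M'.
pose M_ := fix M_ k := if k is k'.+1 then g (k', M_ k') else [set: nat].
have uM k : unbounded (M_ k).
  elim: k => [N|k IH]; first by exists N.
  by have [] := gP (k, M_ k) IH.
have M_sub j k : (j <= k)%N -> M_ k `<=` M_ j.
  move=> /subnK <-; elim: (k - j)%N => [?|i IH]; first by [].
  rewrite addSn; have [sub _ _] := gP ((i + j)%N, M_ (i + j)%N) (uM (i + j)%N).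
  exact: subset_trans sub IH.
have /choice[nxt nxtP] : forall kN : nat * nat, exists n, (kN.2 <= n)%N /\ M_ kN.1 n.
  by move=> [k N]; have [n] := uM k N; exists n.
pose phi := fix phi n := if n is n'.+1 then nxt (n, (phi n').+1) else nxt (0%N, 0%N).
have phi_incr n : (phi n < phi n.+1)%N by have [] := nxtP (n.+1, (phi n).+1).
have phiM n : M_ n (phi n).
  case: n => [|n]; first by have [] := nxtP (0%N, 0%N).
  by have [] := nxtP (n.+1, (phi n).+1).
have phi_ge n : (n <= phi n)%N.
  by elim: n => [//|n IH]; exact: leq_ltn_trans IH (phi_incr n).
exists phi => // f df.
have ball_cvg h : ball h -> cvgn (fun n => h (x (phi n))).
  move=> Sh; apply: (@cvgn_no_oscillation _ 1) => [n|p q pq [uq up]].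
    by apply: le_trans (Sh.2 _) _.
  have [k kE] : exists k, (unpickle k : option (rat * rat)) = Some (p, q).
    by exists (pickle (p, q)); exact: pickleK.
  have [_ _] := gP (k, M_ k) (uM k); rewrite /fst kE => /(_ pq h Sh); apply.
  have uside (Q : set nat) : unbounded [set n | Q (phi n)] ->
      unbounded (M_ k.+1 `&` Q).
    move=> uQ N; have [n] := uQ (maxn N k.+1).
    rewrite geq_max => /andP[Nn kn] Qn; exists (phi n); first exact: leq_trans (phi_ge n).
    by split => //; apply: (M_sub _ _ kn); exact: phiM.
  by case; apply: uside.
have [C C0 fC] := dual_bound df; have [lf _] := df.
have bC : ball (fun z => C^-1 * f z).
  split; last by move=> z; rewrite normrM normfV (gtr0_norm C0) ler_pdivrMl.
  apply: (@dual_of_bound _ _ _ 1); first by move=> a u v; rewrite lf; ring.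
  by move=> z; rewrite normrM normfV (gtr0_norm C0) ler_pdivrMl// mul1r.
have -> : (fun n => f ((x \o phi) n)) = (fun n => C * (C^-1 * f (x (phi n)))).
  by apply/funext => n /=; rewrite mulrA divff ?mul1r// gt_eqF.
by apply: is_cvgM; [exact: is_cvg_cst|exact: ball_cvg bC].
Qed.

End rosenthal.

(** * Passage from (M) to its dual property *)

Section norming_sequences.
Context {R : realType} (X : completeNormedModType R).
Hypothesis nol1 : ~ contains_copy_of_ell1 X.

(** Nearly norming vectors at indices near the upper limit, thinned by Rosenthal's theorem. The
    bound [k <= psi k] is enough to carry weak* nullity over to [f_ (psi k)]. *)
Lemma norming_weakly_cauchy (u : X -> R) (f_ : nat -> X -> R) (l : R) :
  dual X u -> (forall n, dual X (f_ n)) ->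
  (l%:E <= limsup (fun n => dual_norm (u + f_ n)%R))%E ->
  exists (psi : nat -> nat) (x : nat -> X), [/\ forall k, (k <= psi k)%N,
    forall k, `|x k| <= 1, weakly_cauchy x &
    forall e, 0 < e -> exists N, forall k, (N <= k)%N ->
      l - e <= u (x k) + f_ (psi k) (x k)].
Proof.
move=> du df /limsup_ge lu.
have /choice[g gP] : forall k, exists nx : nat * X, [/\ (k <= nx.1)%N, `|nx.2| <= 1 &
    l - 2 * harmonic k <= u nx.2 + f_ nx.1 nx.2].
  move=> k; have [n kn ln] := lu _ (@harmonic_gt0 R k) k.
  have [z z1 zn] := dual_norm_attain (dualD du (df n)) (@harmonic_gt0 R k).
  exists (n, z); split => //; move: ln zn; rewrite !fctE.
  by move: (harmonic k) => h /=; lra.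
have [|phi phi_incr wx] := @rosenthal_l1 _ _ (fun k => (g k).2) _ nol1.
  by move=> k; have [] := gP k.
have phi_ge n : (n <= phi n)%N.
  by elim: n => [//|n IH]; exact: leq_ltn_trans IH (phi_incr n).
exists (fun k => (g (phi k)).1), (fun k => (g (phi k)).2); split => //.
- by move=> k; have [+ _ _] := gP (phi k); exact: leq_trans.
- by move=> k; have [] := gP (phi k).
move=> e e0; have [|N hN] := (cvgn_eventually _ _).1 (@cvg_harmonic R) (e / 2).
  by lra.
exists N => k Nk; have [_ _] := gP (phi k).
have := hN _ (leq_trans Nk (phi_ge k)).
by rewrite subr0 (ger0_norm (ltW (harmonic_gt0 _))); lra.
Qed.

Lemma weakstar_null_psi (f_ : nat -> X -> R) (psi : nat -> nat) z e :
  weakstar_null f_ -> (forall k, (k <= psi k)%N) -> 0 < e ->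
  exists N, forall k, (N <= k)%N -> `|f_ (psi k) z| <= e.
Proof.
move=> [_ f0] psi_ge e0; have [N hN] := (cvgn_eventually _ _).1 (f0 z) _ e0.
by exists N => k Nk; rewrite -[_ z]subr0; apply: hN; exact: leq_trans (psi_ge k).
Qed.

Hypothesis MX : property_M X.

(** The test vector is [z - D + x k] with [z] of norm at most [d] nearly norming [v]: there [v] is
    about |v| d, at least the limit of [u (x k)], while [f_ (psi k)] nearly vanishes at the fixed
    [z] and [D]. *)
Lemma limsup_dual_norm_le (u v : X -> R) (f_ : nat -> X -> R) :
  dual X u -> dual X v -> dual_norm u = dual_norm v -> weakstar_null f_ ->
  (limsup (fun n => dual_norm (u + f_ n)%R) <= limsup (fun n => dual_norm (v + f_ n)%R))%E.
Proof.
move=> du dv uv f0; have [df _] := f0; apply: ereal_le_fin => l lu.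
have [psi [x [psi_ge x1 wx fx]]] := norming_weakly_cauchy du df lu.
have [d [d0 _ dfun dtrans]] := hull_translate MX x1 wx.
have [a ua] := (cvg_ex _).1 (wx u du).
have ad := dfun _ _ du ua.
have [lv _] := dv.
(* The choice of [w] loses [d * e]; one [e] each is lost for [v] at [x k - D], for [f_ (psi k)] at
   [z] and at [D], for the norming and for the limit [a]. *)
apply: (@limsup_ge_scaled _ _ _ (d + 5)); [|by lra|].
  by move=> n; apply: dual_norm_ge0; exact: dualD.
move=> e e0 N.
have [w w1 vw] := dual_norm_attain dv e0.
pose z := d *: w.
have zd : `|z| <= d by rewrite normrZ (ger0_norm d0) ler_piMr.
have vz : dual_norm v * d - d * e <= v z.
  by rewrite /z (functionalZ _ _ lv); have := ler_wpM2l d0 (ltW vw); lra.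
have [m vm] := hull_diff_functional wx dv e0.
have [D KD [N1 hN1]] := dtrans z e m zd e0.
have [N2 hN2] := weakstar_null_psi z f0 psi_ge e0.
have [N3 hN3] := weakstar_null_psi D f0 psi_ge e0.
have [N4 hN4] := fx e e0.
have [N5 hN5] := (cvgn_eventually _ _).1 ua e e0.
have [k /and5P[Nk mk /hN1 h1 /hN2 h2 /and4P[/hN3 h3 /hN4 h4 /hN5 h5 _]]] :=
  exists_ub_seq [:: N; m; N1; N2; N3; N4; N5].
exists (psi k); first exact: leq_trans (psi_ge k).
have [lk _] := df (psi k).
have dvk := dualD dv (df (psi k)).
have h6 : `|v (x k - D)| <= e.
  by apply: vm; exists (x k), D; split => //; exact: tail_hull_seq.
have := dual_norm_bound (z - D + x k) dvk => /(le_trans (ler_norm _)).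
have := ler_wpM2l (dual_norm_ge0 dvk) h1 => h7 /le_trans/(_ h7).
apply: le_trans.
have -> : z - D + x k = z + (x k - D) by rewrite addrAC addrA.
rewrite fctE (functionalD _ _ lv) (functionalD _ _ lk) (functionalB _ _ lk).
move: h2 h3 h5 h6; rewrite !ler_norml => /andP[? _] /andP[_ ?] /andP[_ ?] /andP[? _].
by rewrite uv in ad; lra.
Qed.

Lemma property_Mstar_of_M : property_Mstar X.
Proof.
move=> u v f_ du dv uv f0; apply/eqP; rewrite eq_le.
by rewrite !limsup_dual_norm_le.
Qed.

End norming_sequences.

(** * Hoelder's inequality in the plane and its equality case *)

Section lp_norm2_theory.
Context {R : realType}.
Implicit Types a b c r s : R.

Lemma conjugate_cases (p q : \bar R) : (1 < p)%E -> (p^-1 + q^-1 = 1)%E ->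
  (exists p' q' : R, [/\ p = p'%:E, q = q'%:E, 1 < p', 1 < q' & p'^-1 + q'^-1 = 1]) \/
  (p = +oo%E /\ q = 1%E).
Proof.
case: p => [p| |//]; last first.
  by move=> _; rewrite invey add0e => /eqP; rewrite inve_eq1 => /eqP ->; right.
rewrite lte_fin => p1; have p0 : p != 0 by rewrite gt_eqF//; lra.
have pV1 : p^-1 < 1 by rewrite invf_lt1//; lra.
have pV0 : 0 < p^-1 by rewrite invr_gt0; lra.
rewrite inver (negPf p0); case: q => [q| |].
- rewrite inver; case: eqP => [//|/eqP q0]; rewrite -EFinD => /eqP; rewrite eqe => /eqP pq.
  left; exists p, q; split => //.
  have qV : 0 < q^-1 < 1 by apply/andP; split; lra.
  have {qV} [q_gt0 q1] : 0 < q /\ q^-1 < 1 by move: qV => /andP[]; rewrite invr_gt0.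
  by rewrite -invf_lt1.
- by rewrite invey adde0 => /eqP; rewrite eqe => /eqP h; exfalso; lra.
- by rewrite inveNy.
Qed.

Lemma lp_norm2_fin p a b : lp_norm2 p%:E a%:E b%:E = ((a `^ p + b `^ p) `^ p^-1)%:E.
Proof. by []. Qed.

Lemma lp_norm2y (q : \bar R) a : (1 <= q)%E -> lp_norm2 q a%:E +oo = +oo%E.
Proof.
case: q => [q| |//] q1; rewrite /lp_norm2; last by rewrite maxey.
rewrite poweR_EFin poweRyr; last by rewrite gt_eqF//; move: q1; rewrite lee_fin; lra.
by rewrite addey// poweRyr// invr_eq0 gt_eqF//; move: q1; rewrite lee_fin; lra.
Qed.

Lemma lp_norm2_ge_r (q : \bar R) a b : (1 <= q)%E -> 0 <= b -> (b%:E <= lp_norm2 q a%:E b%:E)%E.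
Proof.
case: q => [q| |//] q1 b0; last by rewrite /= le_max lexx orbT.
have {}q1 : 1 <= q by move: q1; rewrite lee_fin.
have q0 : 0 < q by lra.
rewrite lp_norm2_fin lee_fin -[leLHS]powRr1// -(mulfV (lt0r_neq0 q0)) powRrM.
apply: ge0_ler_powR; rewrite ?invr_ge0 ?(ltW q0) ?nnegrE ?addr_ge0 ?powR_ge0//.
by rewrite lerDr powR_ge0.
Qed.

Lemma lp_norm2_le (p : \bar R) a b c s : (1 < p)%E -> 0 <= a -> a <= c -> 0 <= b -> b <= s ->
  (lp_norm2 p a%:E b%:E <= lp_norm2 p c%:E s%:E)%E.
Proof.
case: p => [p| |//] p1 a0 ac b0 bs; last first.
  by rewrite /= -!EFin_max lee_fin ge_max !le_max ac bs orbT.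
have p0 : 0 < p by move: p1; rewrite lte_fin; lra.
have c0 : 0 <= c by lra.
have s0 : 0 <= s by lra.
rewrite !lp_norm2_fin lee_fin.
apply: ge0_ler_powR; rewrite ?invr_ge0 ?(ltW p0) ?nnegrE ?addr_ge0 ?powR_ge0//.
by apply: lerD; apply: ge0_ler_powR; rewrite ?(ltW p0).
Qed.

Variables (p q : \bar R).
Hypotheses (p1 : (1 < p)%E) (pq : (p^-1 + q^-1 = 1)%E).

Lemma conjugate_ge1 : (1 <= q)%E.
Proof.
have [[p' [q' [_ -> _ q1 _]]]|[_ ->//]] := conjugate_cases p1 pq.
by rewrite lee_fin ltW.
Qed.

Lemma lp_norm2_hoelder a b c s : 0 <= a -> 0 <= b -> 0 <= c -> 0 <= s ->
  (lp_norm2 p c%:E s%:E <= 1)%E -> ((a * c + b * s)%:E <= lp_norm2 q a%:E b%:E)%E.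
Proof.
move=> a0 b0 c0 s0.
have [[p' [q' [-> -> p'1 q'1 pq']]]|[-> ->]] := conjugate_cases p1 pq.
  rewrite !lp_norm2_fin !lee_fin => cs.
  have p'0 : 0 < p' by lra.
  have q'0 : 0 < q' by lra.
  have := hoelder2 c0 s0 a0 b0 p'0 q'0 pq'; rewrite !(mulrC _ a) !(mulrC _ b).
  move=> /le_trans; apply; rewrite -[leRHS]mul1r.
  by rewrite ler_wpM2r ?powR_ge0.
rewrite lp_norm2_fin invr1 !powRr1// ?addr_ge0// /= -EFin_max !lee_fin ge_max.
move=> /andP[c1 s1].
by rewrite lerD// ler_piMr.
Qed.

(** For finite exponents the extremal pair is [(a / n) ^ (q - 1)], [(b / n) ^ (q - 1)] with [n] the
    q-norm of the pair [a], [b]; it is a unit vector because [(q - 1) p = q]. *)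
Lemma lp_norm2_dual a b : 0 <= a -> 0 <= b -> exists c s,
  [/\ 0 <= c, 0 <= s, (lp_norm2 p c%:E s%:E <= 1)%E &
    (lp_norm2 q a%:E b%:E <= (a * c + b * s)%:E)%E].
Proof.
move=> a0 b0.
have [[p' [q' [-> -> p'1 q'1 pq']]]|[-> ->]] := conjugate_cases p1 pq; last first.
  exists 1, 1; rewrite lp_norm2_fin invr1 !powRr1// ?addr_ge0// !mulr1.
  by rewrite /= maxxx; split.
have p'0 : 0 < p' by lra.
have q'0 : 0 < q' by lra.
pose n := (a `^ q' + b `^ q') `^ q'^-1.
have n0 : 0 <= n by exact: powR_ge0.
have nq : n `^ q' = a `^ q' + b `^ q'.
  by rewrite /n -powRrM mulVf ?gt_eqF// powRr1 ?addr_ge0 ?powR_ge0.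
have [nz|nz] := eqVneq n 0.
  exists 0, 0; rewrite !lp_norm2_fin -/n nz !mulr0 addr0 powR0 ?gt_eqF// addr0.
  by rewrite powR0 ?gt_eqF ?invr_gt0// lee_fin; split.
have {}n0 : 0 < n by rewrite lt_neqAle eq_sym nz.
have qp : (q' - 1) * p' = q'.
  have : p' + q' = p' * q'.
    have -> : p' + q' = p' * q' * (p'^-1 + q'^-1) by field; lra.
    by rewrite pq' mulr1.
  by lra.
have powE z : 0 <= z -> ((z / n) `^ (q' - 1)) `^ p' = z `^ q' / n `^ q'.
  move=> z0; rewrite -powRrM qp powRM ?invr_ge0 ?(ltW n0)//.
  by rewrite -(powR_inv1 (ltW n0)) -powRrM mulN1r powRN.
have mulE z : 0 <= z -> z * (z / n) `^ (q' - 1) = n * (z `^ q' / n `^ q').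
  move=> z0; rewrite -powE// -powRrM qp -[(z / n) `^ q']mulr_powRB1 ?divr_ge0 ?(ltW n0)//.
  by move: (_ `^ _) => P; field; rewrite gt_eqF.
exists ((a / n) `^ (q' - 1)), ((b / n) `^ (q' - 1)).
have S0 : a `^ q' + b `^ q' != 0 by rewrite -nq gt_eqF// powR_gt0.
rewrite !lp_norm2_fin !powE// !mulE// -mulrDr -!mulrDl nq divff//.
by rewrite powR1 mulr1; split; rewrite ?powR_ge0.
Qed.

End lp_norm2_theory.

Lemma limsup_fin {R : realType} (u : nat -> R) (C : R) : (forall n, 0 <= u n) ->
  (limsup u <= C%:E)%E -> exists r, [/\ 0 <= r, r <= C & limsup u = r%:E].
Proof.
move=> /limsup_ge0; case: (limsup u) => // r.
by rewrite !lee_fin => r0 rC; exists r.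
Qed.

(** * Passage from (m_p) to the dual property with conjugate exponent *)

Section property_mstar.
Context {R : realType} (X : completeNormedModType R).
Hypotheses (MX : property_M X) (nol1 : ~ contains_copy_of_ell1 X).
Variables (p q : \bar R).
Hypotheses (p1 : (1 < p)%E) (pq : (p^-1 + q^-1 = 1)%E) (mX : property_m X p).
Variables (u : X -> R) (f_ : nat -> X -> R).
Hypotheses (du : dual X u) (f0 : weakstar_null f_).
Let df : forall n, dual X (f_ n) := f0.1.
Let N_ n := dual_norm (u + f_ n).

(** [D_ m] is fixed first and [k_ m] taken so late that the functional nearly kills [D_ m]; the
    differences [x (k_ m) - D_ m] are then weakly null when [x] is weakly Cauchy. *)
Let hull_translate_seq (x : nat -> X) (psi : nat -> nat) (v : X) :
  (forall k, (k <= psi k)%N) ->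
  (forall (e : R) m, 0 < e -> exists2 D, tail_hull x m D &
    exists N, forall n, (N <= n)%N -> `|v - D + x n| <= 1 + e) ->
  exists (k_ : nat -> nat) (D_ : nat -> X), forall m,
    [/\ (m <= k_ m)%N, hull_diff x m (x (k_ m) - D_ m),
      `|v + (x (k_ m) - D_ m)| <= 1 + harmonic m &
      `|f_ (psi (k_ m)) (D_ m)| <= harmonic m].
Proof.
move=> psi_ge vD.
have /choice[kD kDP] : forall m, exists kD : nat * X,
    [/\ (m <= kD.1)%N, hull_diff x m (x kD.1 - kD.2),
      `|v + (x kD.1 - kD.2)| <= 1 + harmonic m &
      `|f_ (psi kD.1) kD.2| <= harmonic m].
  move=> m; have h0 := @harmonic_gt0 R m.
  have [D KD [N1 h1]] := vD _ m h0.
  have [N2 h2] := weakstar_null_psi D f0 psi_ge h0.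
  have [k /and4P[mk /h1 k1 /h2 k2 _]] := exists_ub_seq [:: m; N1; N2].
  exists (k, D); split => //; last by rewrite (addrC (x k)) addrA.
  by exists (x k), D; split => //; exact: tail_hull_seq.
by exists (fun m => (kD m).1), (fun m => (kD m).2) => m; exact: kDP.
Qed.

(** With [rho] the upper limit of the |y m|, (m_p) applied to [v + y m] shows that [d], [rho] has
    p-norm at most 1. As [u] is asymptotically at most |u| d and the functionals at most [b * rho],
    Hoelder's inequality concludes. *)
Lemma limsup_dual_norm_le_lp :
  (limsup N_ <= lp_norm2 q (dual_norm u)%:E (limsup (fun n => dual_norm (f_ n))))%E.
Proof.
have q1 := conjugate_ge1 p1 pq.
have : (0 <= limsup (fun n => dual_norm (f_ n)))%E.
  by apply: limsup_ge0 => n; exact: dual_norm_ge0.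
case be : (limsup (fun n => dual_norm (f_ n))) => [b| |//]; last first.
  by move=> _; rewrite lp_norm2y// leey.
rewrite lee_fin => b0; apply: ereal_le_fin => l lu.
have [psi [x [psi_ge x1 wx fx]]] := norming_weakly_cauchy nol1 du df lu.
have [d [d0 [v vd] dfun dtrans]] := hull_translate MX x1 wx.
have [a ua] := (cvg_ex _).1 (wx u du).
have ad := dfun _ _ du ua.
have [|k_ [D_ kP]] := @hull_translate_seq x psi v psi_ge.
  by move=> e m e0; apply: dtrans => //; rewrite vd.
pose y m := x (k_ m) - D_ m.
have By m : hull_diff x m (y m) by have [] := kP m.
have wy : weakly_null y by exact: weakly_null_hull_diff wx _ By.
have [||rho [rho0 _ rhoE]] := @limsup_fin _ (fun m => `|y m|) (1 + 1).
- by move=> n.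
- by apply/limsup_le => e e0; exists 0%N => n _; have := hull_diff_norm x1 (By n); lra.
have drho : (lp_norm2 p d%:E rho%:E <= 1)%E.
  rewrite -rhoE -vd -mX//; apply/limsup_le => e e0.
  have [N hN] := (cvgn_eventually _ _).1 (@cvg_harmonic R) e e0.
  exists N => m Nm; have [_ _ h _] := kP m; apply: le_trans h _.
  by have := hN m Nm; rewrite subr0 => /(le_trans (ler_norm _)); lra.
have := lp_norm2_hoelder p1 pq (dual_norm_ge0 du) b0 d0 rho0 drho.
apply: le_trans; rewrite lee_fin; apply/ler_addgt0Pr => e' e'0.
(* Three errors [e], the cross terms [(b + rho) * e] and [e * e <= e] add up to [C * e], which this
   [e] keeps below [e']. *)
pose C := 4 + b + rho; have C0 : 0 < C by rewrite /C; lra.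
pose e := e' / (C + e').
have e0 : 0 < e by rewrite divr_gt0//; lra.
have e1 : e <= 1 by rewrite ler_pdivrMr; lra.
have eC : C * e <= e'.
  rewrite /e mulrA ler_pdivrMr; last lra.
  by have := mulr_gt0 e'0 e'0; lra.
have /limsup_le/(_ e e0)[N1 h1] : (limsup (fun n => dual_norm (f_ n)) <= b%:E)%E by rewrite be.
have /limsup_le/(_ e e0)[N2 h2] : (limsup (fun m => `|y m|)%R <= rho%:E)%E by rewrite rhoE.
have [N3 h3] := (cvgn_eventually _ _).1 (@cvg_harmonic R) e e0.
have [N4 h4] := fx e e0.
have [N5 h5] := (cvgn_eventually _ _).1 ua e e0.
have [m /and5P[m1 /h2 m2 /h3 m3 m4 /andP[m5 _]]] := exists_ub_seq [:: N1; N2; N3; N4; N5].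
have [mk _ _ fD] := kP m.
have {}m1 := h1 _ (leq_trans m1 (leq_trans mk (psi_ge _))).
have {}m4 := h4 _ (leq_trans m4 mk).
have {m5} := h5 _ (leq_trans m5 mk) => /(le_trans (ler_norm _)) m5.
rewrite subr0 in m3; have {}m3 := le_trans (ler_norm _) m3.
have [lf _] := df (psi (k_ m)).
have fy := le_trans (ler_norm _) (dual_norm_bound (y m) (df (psi (k_ m)))).
rewrite (functionalB _ _ lf) in fy.
have {}fD := le_trans (ler_norm _) fD.
have le1 : dual_norm (f_ (psi (k_ m))) * `|y m| <= (b + e) * (rho + e).
  by apply: ler_pM => //; exact: dual_norm_ge0.
have le2 : e * e <= e by rewrite ler_piMr// ltW.
by rewrite /C in eC; lra.
Qed.

(** The test vectors are [c *: v + s *: y m] with [c], [s] from the equality case; (m_p) bounds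
    their norms asymptotically by 1. Any real lower bound [b] is allowed, which covers an infinite
    upper limit. *)
Lemma lp_le_limsup_dual_norm b : 0 <= b ->
  (b%:E <= limsup (fun n => dual_norm (f_ n)))%E ->
  (lp_norm2 q (dual_norm u)%:E b%:E <= limsup N_)%E.
Proof.
move=> b0 bf.
have [c [s [c0 s0 cs /le_trans]]] := lp_norm2_dual p1 pq (dual_norm_ge0 du) b0.
apply.
have d0 : dual X (0 : X -> R).
  apply: (@dual_of_bound _ _ _ 0) => [z y w|y].
    by rewrite -[LHS]/(0 : R) -[RHS]/(z * 0 + 0 : R) mulr0 addr0.
  by rewrite -[(0 : X -> R) y]/(0 : R) normr0 mul0r.
(* Taking 0 in place of [u] makes [x] norm the functionals [f_] alone; translating by the vector 0
   then keeps |y m| below [1 + harmonic m]. *)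
have [|psi [x [psi_ge x1 wx fx]]] := @norming_weakly_cauchy _ _ nol1 0 f_ b d0 df.
  by under eq_fun do rewrite add0r.
have [d [dge0 _ _ dtrans]] := hull_translate MX x1 wx.
have [|k_ [D_ kP]] := @hull_translate_seq x psi 0 psi_ge.
  by move=> e m e0; apply: dtrans => //; rewrite normr0.
pose y m := x (k_ m) - D_ m.
have By m : hull_diff x m (y m) by have [] := kP m.
have wy : weakly_null (fun m => s *: y m).
  have := weakly_null_scale (r := s) (weakly_null_hull_diff wx); apply.
  by move=> m; exists (y m).
have y_le m : `|y m| <= 1 + harmonic m by have [_ _ + _] := kP m; rewrite add0r.
have sy : (limsup (fun m => `|s *: y m|)%R <= s%:E)%E.
  apply/limsup_le => e e0.
  have es : 0 < e / (1 + s) by rewrite divr_gt0//; lra.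
  have [N hN] := (cvgn_eventually _ _).1 (@cvg_harmonic R) _ es.
  exists N => m /hN; rewrite subr0 => /(le_trans (ler_norm _)) hm.
  rewrite normrZ (ger0_norm s0).
  have := ler_wpM2l s0 (le_trans (y_le m) (lerD (lexx 1) hm)).
  have : (1 + s) * (e / (1 + s)) = e by field; lra.
  by lra.
have [|t [t0 ts tE]] := limsup_fin _ sy; first by move=> m.
(* Each of [u] and [f_] loses [e] at [v]; at [y m], [u] loses [e] and [f_] loses [2 * e]. *)
apply: (@limsup_ge_scaled _ _ _ (2 * c + 3 * s)).
- by move=> n; apply: dual_norm_ge0; exact: dualD.
- by lra.
move=> e e0 N; have [v v1 uv] := dual_norm_attain du e0.
have w_le1 : (limsup (fun m => `|c *: v + s *: y m|)%R <= 1)%E.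
  rewrite mX// tE; apply: le_trans cs; apply: lp_norm2_le => //.
  by rewrite normrZ (ger0_norm c0) ler_piMr.
have [N1 h1] := (limsup_le _ _).1 w_le1 e e0.
have [m0 hm0] := hull_diff_functional wx du e0.
have [N2 h2] := weakstar_null_psi v f0 psi_ge e0.
have [N3 h3] := (cvgn_eventually _ _).1 (@cvg_harmonic R) e e0.
have [N4 h4] := fx e e0.
have [m /and5P[Nm /h1 m1 m2 /h3 m3 /and3P[m4 mm0 _]]] :=
  exists_ub_seq [:: N; N1; N2; N3; N4; m0].
have [mk _ _ fD] := kP m.
exists (psi (k_ m)); first exact: leq_trans Nm (leq_trans mk (psi_ge _)).
have [lu _] := du; have [lf _] := df (psi (k_ m)).
have dum := dualD du (df (psi (k_ m))).
have := dual_norm_bound (c *: v + s *: y m) dum => /(le_trans (ler_norm _)).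
have := ler_wpM2l (dual_norm_ge0 dum) m1 => m1' /le_trans/(_ m1').
apply: le_trans.
rewrite fctE (functionalD _ _ lu) (functionalD _ _ lf) !(functionalZ _ _ lu) !(functionalZ _ _ lf).
have uy := hm0 _ (hull_diff_le mm0 (By m)).
have fv := h2 _ (leq_trans m2 mk).
have fxk := h4 _ (leq_trans m4 mk); rewrite -[(0 : X -> R) _]/(0 : R) add0r in fxk.
rewrite subr0 in m3; have {}m3 := le_trans (ler_norm _) m3.
have fy : b - 2 * e <= f_ (psi (k_ m)) (y m).
  by rewrite (functionalB _ _ lf); have := le_trans (ler_norm _) fD; lra.
move: uy fv; rewrite !ler_norml => /andP[uy _] /andP[fv _].
have := ler_wpM2l c0 (ltW uv); have := ler_wpM2l s0 uy.
have := ler_wpM2l c0 fv; have := ler_wpM2l s0 fy.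
by lra.
Qed.

Lemma limsup_dual_norm_lp :
  limsup N_ = lp_norm2 q (dual_norm u)%:E (limsup (fun n => dual_norm (f_ n))).
Proof.
apply/eqP; rewrite eq_le limsup_dual_norm_le_lp /=.
have q1 := conjugate_ge1 p1 pq.
have : (0 <= limsup (fun n => dual_norm (f_ n)))%E.
  by apply: limsup_ge0 => n; exact: dual_norm_ge0.
case be : (limsup (fun n => dual_norm (f_ n))) => [b| |//] b0.
  by apply: lp_le_limsup_dual_norm; rewrite ?be.
(* For an infinite upper limit, the lower estimate is used with [b] equal to |l| for every real
   [l]. *)
rewrite lp_norm2y//; apply: ereal_le_fin => l _.
apply: (@le_trans _ _ `|l|%:E); first by rewrite lee_fin ler_norm.
apply: le_trans (lp_norm2_ge_r (dual_norm u) q1 (normr_ge0 l)) _.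
by apply: lp_le_limsup_dual_norm; rewrite ?normr_ge0 ?be ?leey.
Qed.

End property_mstar.

Theorem theorem3p6 (R : realType) (X : completeNormedModType R)
    (sepX : separable X) (MX : property_M X)
    (nol1 : ~ contains_copy_of_ell1 X) :
  property_Mstar X /\
  forall p q : \bar R, (1 < p)%E -> (p^-1 + q^-1 = 1)%E ->
    property_m X p -> property_mstar X q.
Proof.
split; first exact: property_Mstar_of_M.
by move=> p q p1 pq mX f f_ df f0; exact: (limsup_dual_norm_lp MX nol1 p1 pq mX df f0).
Qed.
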